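(* Let $H$ and $K$ be closed subgroups of a locally compact group $G$ (with identity $e$) that satisfy $K\cap H=\{e\}$ and such that $(k,h)\mapsto kh$ is a homeomorphism of $K\times H$ onto $G$. For $x\in G$ let $k_x\in K$ and $h_x\in H$ be the unique elements with $x=k_xh_x$, and for $x\in G$, $k\in K$ put $x\cdot k=k_{xk}\in K$. Let $\pi$ be a unitary representation of $H$ on a Hilbert space $\mathcal H_\pi$. Then the induced representation $\mathrm{ind}_H^G\pi$ is unitarily equivalent to the representation $\sigma^\pi$ of $G$ acting on $L^2(K,\mathcal H_\pi)$ by $$\sigma^\pi(x)F(k)=\left[\frac{\Delta_H(h_{x^{-1}k})}{\Delta_G(h_{x^{-1}k})}\right]^{1/2}\pi\left((h_{x^{-1}k})^{-1}\right)F(x^{-1}\cdot k),\quad\text{for a.e. }k\in K,$$ for all $F\in L^2(K,\mathcal H_\pi)$ and every $x\in G$.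
   Context: $\mu_G$ denotes left Haar measure on a locally compact group $G$. The modular function $\Delta_G:G\to(0,\infty)$ is the continuous homomorphism with $\Delta_G(y)\int_G f(xy)\,d\mu_G(x)=\int_G f(x)\,d\mu_G(x)$ for all $y\in G$; similarly for $\Delta_H$. A unitary representation $\pi$ of $G$ is a homomorphism $\pi:G\to\mathcal U(\mathcal H_\pi)$ such that $x\mapsto\langle\xi,\pi(x)\eta\rangle$ is continuous for all $\xi,\eta\in\mathcal H_\pi$. $L^2(K,\mathcal H_\pi)$ is the Hilbert space of (classes of) weakly measurable $F:K\to\mathcal H_\pi$ with $\int_K\|F(k)\|^2d\mu_K(k)<\infty$. Induced representation: fix a continuous strictly positive rho-function, i.e. a continuous $\rho:G\to(0,\infty)$ with $\rho(xh)=\frac{\Delta_H(h)}{\Delta_G(h)}\rho(x)$ for $x\in G$, $h\in H$, and the associated regular Borel measure $\mu_\rho$ on $G/H$ with $\int_G f\rho\,d\mu_G=\int_{G/H}\int_H f(p(\omega)h)\,d\mu_H(h)\,d\mu_\rho(\omega)$ for $f\in C_c(G)$, where $p:G/H\to G$ is a cross-section of the $H$-cosets. The Hilbert space of $\mathrm{ind}_H^G\pi$ consists of classes of weakly measurable $\xi:G\to\mathcal H_\pi$ with $\xi(xh)=\pi(h^{-1})\xi(x)$ for all $h\in H$ and a.e. $x\in G$, and $\int_{G/H}\|\xi(p(\omega))\|^2d\mu_\rho(\omega)<\infty$, with inner product $\int_{G/H}\langle\xi_1(p(\omega)),\xi_2(p(\omega))\rangle d\mu_\rho(\omega)$; the action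 is $\mathrm{ind}_H^G\pi(x)\xi(y)=\left[\frac{\rho(x^{-1}y)}{\rho(y)}\right]^{1/2}\xi(x^{-1}y)$. Different choices of $\rho$ give equivalent representations. *)

(* Defs.v *)
From HB Require Import structures.
From mathcomp Require Import all_boot all_order all_algebra.
From mathcomp Require Import sesquilinear complex.
From mathcomp Require Import all_classical all_reals all_analysis.

Set Implicit Arguments.
Unset Strict Implicit.
Unset Printing Implicit Defensive.

Import Order.TTheory GRing.Theory Num.Theory.
Import numFieldNormedType.Exports.

Local Open Scope classical_set_scope.
Local Open Scope ring_scope.

(* Pointedness is only there because [measurableType] requires it; the point is
   not used. *)
HB.mixin Record isTopologicalGroup (G : Type)
    of PointedTopological G & Group G := {
  mulg_continuous : continuous (fun xy : G * G => (xy.1 * xy.2)%g);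
  invg_continuous : continuous (fun x : G => (x^-1)%g)
}.

#[short(type="topGroupType")]
HB.structure Definition TopologicalGroup :=
  {G of PointedTopological G & Group G & isTopologicalGroup G}.

Definition locally_compact_group (G : topGroupType) : Prop :=
  hausdorff_space G /\ locally_compact [set: G].

Record closed_subgroup (G : topGroupType) := ClosedSubgroup {
  csg_set : set G;
  csg1 : csg_set 1%g;
  csgM : forall x y, csg_set x -> csg_set y -> csg_set (x * y)%g;
  csgV : forall x, csg_set x -> csg_set (x^-1)%g;
  csg_closed : closed csg_set
}.

(* The subgroup as a topological group in its own right, with the subspace
   topology that [set_type] carries. *)
Definition csg_type (G : topGroupType) (S : closed_subgroup G) : Type :=
  set_type (csg_set S).
Coercion csg_type : closed_subgroup >-> Sortclass.

Section subgroup_instances.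
Variables (G : topGroupType) (S : closed_subgroup G).
Local Open Scope group_scope.

HB.instance Definition _ := Topological.copy (csg_type S) (set_type (csg_set S)).

Definition csg_val (x : csg_type S) : G := \val x.

Let csg_in (x : csg_type S) : csg_set S (csg_val x).
Proof. exact: set_mem (valP x). Qed.

Definition csg_one : csg_type S := exist _ 1 (mem_set (csg1 S)).
Definition csg_mul (x y : csg_type S) : csg_type S :=
  exist _ (csg_val x * csg_val y) (mem_set (csgM (csg_in x) (csg_in y))).
Definition csg_inv (x : csg_type S) : csg_type S :=
  exist _ (csg_val x)^-1 (mem_set (csgV (csg_in x))).

Lemma csg_val_inj : injective csg_val. Proof. exact: val_inj. Qed.

Let csg_mulA : associative csg_mul.
Proof. by move=> x y z; apply: csg_val_inj; exact: mulgA. Qed.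
Let csg_mul1 : left_id csg_one csg_mul.
Proof. by move=> x; apply: csg_val_inj; exact: mul1g. Qed.
Let csg_mulr1 : right_id csg_one csg_mul.
Proof. by move=> x; apply: csg_val_inj; exact: mulg1. Qed.
Let csg_mulV : left_inverse csg_one csg_inv csg_mul.
Proof. by move=> x; apply: csg_val_inj; exact: mulVg. Qed.
Let csg_mulrV : right_inverse csg_one csg_inv csg_mul.
Proof. by move=> x; apply: csg_val_inj; exact: mulgV. Qed.

HB.instance Definition _ := isPointed.Build (csg_type S) csg_one.
HB.instance Definition _ := isGroup.Build (csg_type S)
  csg_mulA csg_mul1 csg_mulr1 csg_mulV csg_mulrV.

Lemma csg_val_continuous : continuous csg_val.
Proof. exact: initial_continuous. Qed.

Let csg_into (T : topologicalType) (f : T -> csg_type S) :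
  continuous (csg_val \o f) -> continuous f.
Proof. by move=> cf; apply/continuous_comp_initial. Qed.

Let csg_mul_continuous :
  continuous (fun xy : csg_type S * csg_type S => xy.1 * xy.2).
Proof.
apply: csg_into => -[x y]; apply: (@continuous2_cvg _ _ _ _ _ _
    (fun z => csg_val z.1) (fun z => csg_val z.2) (fun u v => u * v)).
- exact: (@mulg_continuous G (csg_val x, csg_val y)).
- by apply: cvg_comp; [exact: cvg_fst | exact: csg_val_continuous].
- by apply: cvg_comp; [exact: cvg_snd | exact: csg_val_continuous].
Qed.
Let csg_inv_continuous : continuous (fun x : csg_type S => x^-1).
Proof.
apply: csg_into => x.
exact: (continuous_comp (@csg_val_continuous x) (@invg_continuous G (csg_val x))).
Qed.

HB.instance Definition _ := isTopologicalGroup.Build (csg_type S)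
  csg_mul_continuous csg_inv_continuous.
End subgroup_instances.

Section coset_space.
Variables (G : topGroupType) (H : closed_subgroup G).
Local Open Scope group_scope.

Definition lcoset_rel : rel G := fun x y => `[< csg_set H (x^-1 * y) >].

Let lcoset_refl : reflexive lcoset_rel.
Proof. by move=> x; apply/asboolP; rewrite mulVg; exact: csg1. Qed.
Let lcoset_sym : symmetric lcoset_rel.
Proof.
have imp x y : lcoset_rel x y -> lcoset_rel y x.
  move=> /asboolP/(csgV (c := H)) Hyx; apply/asboolP.
  by move: Hyx; rewrite invgM invgK.
by move=> x y; apply/idP/idP; exact: imp.
Qed.
Let lcoset_trans : transitive lcoset_rel.
Proof.
move=> y x z /asboolP xy /asboolP yz; apply/asboolP.
by have := csgM xy yz; rewrite mulgA mulgK.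
Qed.

Definition lcoset_equiv := EquivRel lcoset_rel lcoset_refl lcoset_sym lcoset_trans.

Definition coset_space : Type := quotient_topology {eq_quot lcoset_equiv}%qT.
HB.instance Definition _ := PointedTopological.on coset_space.

Definition to_coset (x : G) : coset_space := (\pi_{eq_quot lcoset_equiv} x)%qT.
End coset_space.

Definition borel (T : ptopologicalType) : Type := g_sigma_algebraType (@open T).
HB.instance Definition _ (T : ptopologicalType) := Measurable.on (borel T).


Section haar.
Variables (R : realType).

(* Radon measures in the "inner regular on all Borel sets" convention.  For
   sigma-compact spaces this is the same as "outer regular on Borel sets, inner
   regular on open sets".  Beyond them, it has the advantage that locally null
   Borel sets are null, so that classes of functions modulo almost everywhere
   equality are the right ones. *)
Definition regular_borel (T : ptopologicalType)
    (mu : {measure set (borel T) -> \bar R}) : Prop :=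
  (forall C : set T, compact C -> (mu C < +oo)%E) /\
  (forall A : set (borel T), measurable A ->
     mu A = ereal_sup [set mu C | C in [set C : set T | compact C /\ C `<=` A]]).

Definition left_haar (G : topGroupType)
    (mu : {measure set (borel G) -> \bar R}) : Prop :=
  [/\ regular_borel mu,
      mu setT != 0%E
    & forall (x : G) (A : set (borel G)), measurable A ->
        mu [set (x * y)%g | y in (A : set G)] = mu A].

Definition Cc (T : topologicalType) (f : T -> R) : Prop :=
  continuous f /\ compact (closure [set x | f x != 0]).

Definition modular_function (G : topGroupType)
    (mu : {measure set (borel G) -> \bar R}) (Delta : G -> R) : Prop :=
  [/\ continuous Delta,
      forall x, 0 < Delta x,
      forall x y, Delta (x * y)%g = Delta x * Delta y
    & forall (y : G) (f : G -> R), Cc f ->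
        Delta y * \int[mu]_x f (x * y)%g = \int[mu]_x f x].

Definition rho_function (G : topGroupType) (H : closed_subgroup G)
    (DeltaG : G -> R) (DeltaH : H -> R) (rho : G -> R) : Prop :=
  [/\ continuous rho,
      forall x, 0 < rho x
    & forall (x : G) (h : H),
        rho (x * csg_val h)%g = DeltaH h / DeltaG (csg_val h) * rho x].

Definition cross_section (G : topGroupType) (H : closed_subgroup G)
    (p : coset_space H -> G) : Prop :=
  forall w, to_coset H (p w) = w.

Definition rho_measure (G : topGroupType) (H : closed_subgroup G)
    (muG : {measure set (borel G) -> \bar R})
    (muH : {measure set (borel H) -> \bar R})
    (rho : G -> R) (p : coset_space H -> G)
    (mu : {measure set (borel (coset_space H)) -> \bar R}) : Prop :=
  regular_borel mu /\
  forall f : G -> R, Cc f ->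
    \int[muG]_x (f x * rho x)
    = \int[mu]_w (\int[muH]_h f (p w * csg_val h)%g).

End haar.

Definition homeomorphism (S T : topologicalType) (f : S -> T) : Prop :=
  continuous f /\
  exists g : T -> S, [/\ continuous g, cancel f g & cancel g f].

(* [ip] makes the Banach space V a Hilbert space. *)
Definition hilbert_inner (R : realType) (V : completeNormedModType R[i])
    (ip : {dot V for Num.conj}) : Prop :=
  forall v, ip v v = `|v| ^+ 2.

Definition unitary_rep (R : realType) (V : completeNormedModType R[i])
    (ip : {dot V for Num.conj}) (H : topGroupType) (pi : H -> V -> V) : Prop :=
  [/\ forall h, linear (pi h),
      forall h u v, ip (pi h u) (pi h v) = ip u v,
      forall h v, exists u, pi h u = v,
      forall h h' v, pi (h * h')%g v = pi h (pi h' v)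
    & forall u v, continuous (fun h => ip u (pi h v))].

(* A Hilbert space of classes of functions T -> V, given by the functions that
   represent its elements, the relation "f and g represent the same element",
   and the inner product computed on representatives. *)
Record function_space (R : realType) (V : lmodType R[i]) (T : Type) :=
  FunctionSpace {
    fs_dom : set (T -> V);
    fs_eq : (T -> V) -> (T -> V) -> Prop;
    fs_ip : (T -> V) -> (T -> V) -> R[i]
  }.

Section unitary_equivalence.
Variables (R : realType) (V : lmodType R[i]).

(* U induces a unitary operator from the classes of A onto those of B. *)
Definition unitary_op (S T : Type) (A : function_space V S)
    (B : function_space V T) (U : (S -> V) -> (T -> V)) : Prop :=
  [/\ forall f, fs_dom A f -> fs_dom B (U f),
      forall f g, fs_dom A f -> fs_dom A g ->
        (fs_eq B (U f) (U g) <-> fs_eq A f g),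
      forall (a : R[i]) f g, fs_dom A f -> fs_dom A g ->
        fs_eq B (U (fun s => a *: f s + g s)) (fun t => a *: U f t + U g t),
      forall f g, fs_dom A f -> fs_dom A g ->
        fs_ip B (U f) (U g) = fs_ip A f g
    & forall g, fs_dom B g -> exists2 f, fs_dom A f & fs_eq B (U f) g].

Definition unitary_action (G : groupType) (T : Type) (A : function_space V T)
    (s : G -> (T -> V) -> (T -> V)) : Prop :=
  (forall x, unitary_op A A (s x)) /\
  (forall x y f, fs_dom A f -> fs_eq A (s (x * y)%g f) (s x (s y f))).

Definition unitarily_equivalent (G : groupType) (S T : Type)
    (A : function_space V S) (s : G -> (S -> V) -> (S -> V))
    (B : function_space V T) (t : G -> (T -> V) -> (T -> V)) : Prop :=
  [/\ unitary_action A s,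
      unitary_action B t
    & exists2 U, unitary_op A B U &
        forall x f, fs_dom A f -> fs_eq B (U (s x f)) (t x (U f))].

End unitary_equivalence.

Section spaces.
Variables (R : realType) (V : completeNormedModType R[i]).
Variable ip : {dot V for Num.conj}.

Definition normR (v : V) : R := complex.Re `|v|.

(* As usual on locally compact spaces, measurability is tested on compact sets;
   on sigma-compact spaces this is Borel measurability. *)
Definition weakly_measurable (T : ptopologicalType) (F : T -> V) : Prop :=
  forall (eta : V) (C : set T), compact C ->
    measurable_fun (C : set (borel T)) (fun x => complex.Re (ip (F x) eta)) /\
    measurable_fun (C : set (borel T)) (fun x => complex.Im (ip (F x) eta)).

Definition complex_integral (T : ptopologicalType)
    (mu : {measure set (borel T) -> \bar R}) (f : T -> R[i]) : R[i] :=
  Complex (\int[mu]_x complex.Re (f x)) (\int[mu]_x complex.Im (f x)).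

(* For separable V, [normR \o F] is measurable as soon as F is weakly measurable.
   In general it need not be, and [\int] of a nonnegative function is then the
   supremum of the integrals of the simple measurable functions below it. *)
Definition L2 (T : ptopologicalType)
    (mu : {measure set (borel T) -> \bar R}) : function_space V T :=
  FunctionSpace
    [set F | weakly_measurable F /\
             (\int[mu]_x (normR (F x) ^+ 2)%:E < +oo)%E]
    (fun F1 F2 => {ae mu, forall x, F1 x = F2 x})
    (fun F1 F2 => complex_integral mu (fun x => ip (F1 x) (F2 x))).

Variables (G : topGroupType) (H : closed_subgroup G) (pi : H -> V -> V).

(* "xi(xh) = pi(h^-1) xi(x) for all h and a.e. x": the exceptional null set of x
   does not depend on h.  It is then a union of cosets of H, so the integrals over
   G/H depend neither on the cross-section nor on the representatives. *)
Definition ind_space (muG : {measure set (borel G) -> \bar R})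
    (p : coset_space H -> G)
    (mu_rho : {measure set (borel (coset_space H)) -> \bar R}) :
    function_space V G :=
  FunctionSpace
    [set xi | [/\ weakly_measurable xi,
                  {ae muG, forall x : G, forall h : H,
                     xi (x * csg_val h)%g = pi (h^-1)%g (xi x)}
                & (\int[mu_rho]_w (normR (xi (p w)) ^+ 2)%:E < +oo)%E]]
    (fun xi1 xi2 => {ae muG, forall x, xi1 x = xi2 x})
    (fun xi1 xi2 =>
       complex_integral mu_rho (fun w => ip (xi1 (p w)) (xi2 (p w)))).

Definition ind_action (rho : G -> R) (x : G) (xi : G -> V) : G -> V :=
  fun y => (Num.sqrt (rho (x^-1 * y)%g / rho y))%:C%C *: xi (x^-1 * y)%g.

Definition sigma_action (K : closed_subgroup G)
    (DeltaG : G -> R) (DeltaH : H -> R) (kpart : G -> K) (hpart : G -> H)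
    (x : G) (F : K -> V) : K -> V :=
  fun k =>
    let y := (x^-1 * csg_val k)%g in
    (Num.sqrt (DeltaH (hpart y) / DeltaG (csg_val (hpart y))))%:C%C
      *: pi ((hpart y)^-1)%g (F (kpart y)).

End spaces.

(* Main.v *)
Require Import Defs.
From HB Require Import structures.
From mathcomp Require Import all_boot all_order all_algebra.
From mathcomp Require Import sesquilinear complex finmap ring lra.
From mathcomp Require Import all_classical all_reals all_analysis.
From mathcomp Require Import measurable_realfun.

Set Implicit Arguments.
Unset Strict Implicit.
Unset Printing Implicit Defensive.

Import Order.TTheory GRing.Theory Num.Theory.
Import numFieldNormedType.Exports.

Local Open Scope classical_set_scope.
Local Open Scope ring_scope.

(* Identify G/H with K through k |-> kH, and x with (k_x, h_x). Testing the
   identity that defines mu_rho on the functions phi(k_x) psi(h_x) and their left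
   translates shows that the image lam of mu_rho on K satisfies
     int phi(x^-1 . k) dlam(k) = int phi(k) rho(xk) / rho(k) dlam(k).
   For x in K this says that rho^-1 lam is left invariant, so lam = c rho mu_K by
   uniqueness of Haar measure, and for general x it becomes the change of variables
   that makes sigma^pi(x) isometric. Hence U xi(k) = (c rho(k))^(1/2) xi(k) is
   isometric; its inverse maps F to x |-> (c rho(k_x))^(-1/2) pi(h_x^-1) F(k_x).
   That U respects classes means that S is null in K iff SH is null in G: for W
   open and relatively compact in H, B |-> mu_G(BW) is a Haar measure of K.
   Integrands need not be measurable when the Hilbert space is not separable, so
   every change of variables is proved for lower integrals of arbitrary
   nonnegative functions. *)

(** * Compact sets and test functions *)

(** G is not assumed sigma-compact, so the measures need not be sigma-finite, and this shapes the
    proof. Tonelli's theorem is used only for functions of compact support, after restriction to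
    compact sets. Comparisons of integrals are tested on C_c and then extended to arbitrary
    nonnegative functions by regularity; an equality is obtained as two inequalities, the second
    coming from the inverse homeomorphism. Null sets are controlled through their compact subsets.
    Densities such as rho^-1 remain factors of integrands and are never turned into measures; this
    is why uniqueness of Haar measure is proved for a measure together with a continuous weight. The
    constant c is present because the Haar measures of G, H and K are normalized independently; it
    is positive because the G-integral of a nonzero nonnegative test function is. The cross-section
    p is arbitrary, possibly discontinuous, and enters only through the K-part of p(w), which is
    continuous in w. *)

Lemma bigcup_fset_compact (X : topologicalType) (I : choiceType) (D : {fset I})
    (F : I -> set X) :
  (forall i, i \in D -> compact (F i)) -> compact (\bigcup_(i in [set` D]) F i).
Proof.
move=> cF; rewrite -bigsetU_fset_set// set_fsetK big_seq.
by apply: bigsetU_compact.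
Qed.

Lemma compact_fset_cover (X : topologicalType) (C : set X) (I : choiceType)
    (D : set I) (f : I -> set X) :
  compact C -> (forall i, D i -> open (f i)) -> C `<=` cover D f ->
  finite_subset_cover D f C.
Proof.
move=> cC oF CF.
have [->|/set0P[x0 _]] := eqVneq C set0.
  by exists fset0%fset => // i; rewrite inE.
(* [cover_compact] is stated for pointed spaces; a point of C serves as base point. *)
pose XP : ptopologicalType := HB.pack X (isPointed.Build X x0).
have : @cover_compact XP C by rewrite -compact_cover.
exact.
Qed.

Lemma compact_interior_cover (X : topologicalType) (C : set X) :
  locally_compact [set: X] -> compact C ->
  exists2 D : set X, compact D & C `<=` D°.
Proof.
move=> lcX cC.
have nb (x : X) : exists D : set X, compact D /\ nbhs x D.
  have [U] := lcX x I; rewrite withinET => Ux [cU _].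
  by exists U.
pose N (x : X) := projT1 (cid (nb x)).
have cN (x : X) : compact (N x) by have [] := projT2 (cid (nb x)).
have nN (x : X) : nbhs x (N x) by have [] := projT2 (cid (nb x)).
case: (@compact_fset_cover X C X C (fun x => (N x)°) cC) => [x _|x Cx|D' _ CD'].
- exact: open_interior.
- by exists x => //; exact: nN.
exists (\bigcup_(i in [set` D']) N i).
  by apply: (@bigcup_fset_compact X _ D' N) => i _; exact: cN.
move=> x /CD' [y /= yD' yx].
by apply: filterS yx => z Nz; exists y.
Qed.

Lemma continuous_compact_bound (R : realType) (X : topologicalType)
    (f : X -> R) (C : set X) : continuous f -> compact C ->
  exists2 M : R, 0 < M & forall x, C x -> `|f x| <= M.
Proof.
move=> cf cC; have /compact_bounded[M [Mreal hM]] : compact (f @` C).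
  by apply: continuous_compact => //; exact: continuous_subspaceT.
exists (Num.max 1 (M + 1)); first by rewrite lt_max ltr01.
move=> x Cx; apply: (hM (Num.max 1 (M + 1))); last by exists x.
by rewrite lt_max ltrDl ltr01 orbT.
Qed.

(* Urysohn's lemma is applied in the one-point compactification, which is a
   compact Hausdorff and hence normal space. *)
Lemma urysohn_Cc (R : realType) (X : topologicalType) (C U : set X) :
  hausdorff_space X -> locally_compact [set: X] ->
  compact C -> open U -> C `<=` U ->
  exists f : X -> R, [/\ Cc f, forall x, 0 <= f x <= 1,
    forall x, C x -> f x = 1 & forall x, ~ U x -> f x = 0].
Proof.
move=> hX lcX cC oU CU.
have [D cD CD] := compact_interior_cover lcX cC.
pose opc := one_point_compactification X.
have hopc : hausdorff_space opc by exact: one_point_compactification_hausdorff.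
have nopc : normal_space opc.
  by apply: compact_normal => //; exact: one_point_compactification_compact.
pose A : set opc := Some @` C.
(* B contains the point at infinity and everything outside D°; vanishing on B therefore forces
   compact support. *)
pose B : set opc := ~` (Some @` (U `&` D°)).
have cA : closed A.
  apply: compact_closed => //; apply: continuous_compact => //.
  apply: continuous_subspaceT.
  exact: one_point_compactification_some_continuous.
have cB : closed B.
  apply: open_closedC; apply: one_point_compactification_open_some.
  by apply: openI => //; exact: open_interior.
have AB : B `&` A = set0.
  apply/seteqP; split => // z [+ [x Cx xz]]; apply; rewrite -xz.
  by exists x => //; split; [exact: CU|exact: CD].
have /(@uniform_separatorP _ R) : uniform_separator B A.
  exact: normal_uniform_separator.
move=> [f [cf f01 f0 f1]].
have f0' x : ~ (U `&` D°) x -> f (Some x) = 0.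
  by move=> Ux; apply: f0; exists (Some x) => //= -[y Uy [yx]]; apply: Ux; rewrite -yx.
exists (f \o Some); split.
- split; first by move=> x; exact: cf.
  apply: (@subclosed_compact _ _ D) => //; first exact: closed_closure.
  have clD : closed D by exact: compact_closed.
  rewrite [X in _ `<=` X]((closure_id D).1 clD).
  apply: closureS => x /= fx; apply: contrapT => Dx.
  by move: fx; rewrite f0' ?eqxx// => -[_] /interior_subset.
- by move=> x; have := f01 (f (Some x)); apply; exists (Some x).
- by move=> x Cx; apply: f1; exists (Some x) => //; exists x.
- by move=> x Ux; apply: f0' => -[].
Qed.

(** * Lower integrals and Radon measures *)

Section integral_complements.
Context d (T : measurableType d) (R : realType).
Variable mu : {measure set T -> \bar R}.
Local Open Scope ereal_scope.
Import HBNNSimple.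

(* No measurability here: [\int] of a nonnegative function is a lower integral. *)
Lemma ge0_le_integralT (f g : T -> \bar R) :
  (forall x, 0 <= f x) -> (forall x, f x <= g x) ->
  \int[mu]_x f x <= \int[mu]_x g x.
Proof.
move=> f0 fg; have g0 x : 0 <= g x := le_trans (f0 x) (fg x).
rewrite !ge0_integralTE//; apply: ereal_sup_le => _ [h hf <-].
by exists h => // x; exact: le_trans (hf x) (fg x).
Qed.

Lemma ge0_integral_le_nnsfun (f : T -> \bar R) (M : \bar R) :
  (forall x, 0 <= f x) ->
  (forall h : {nnsfun T >-> R}, (forall x, (h x)%:E <= f x) ->
    \int[mu]_x (h x)%:E <= M) ->
  \int[mu]_x f x <= M.
Proof.
move=> f0 hM; rewrite ge0_integralTE//; apply: ge_ereal_sup => _ [h hf <-].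
by have := hM h hf; rewrite integralT_nnsfun.
Qed.

(** The exceptional set is removed from the integral of a simple function below [f], which is
    measurable even when [f] and [g] are not. *)
Lemma ae_ge0_le_integralT (f g : T -> \bar R) :
  (forall x, 0 <= f x) -> (forall x, 0 <= g x) ->
  {ae mu, forall x, f x <= g x} -> \int[mu]_x f x <= \int[mu]_x g x.
Proof.
move=> f0 g0 [N [mN N0 fgN]]; apply: ge0_integral_le_nnsfun => // h hf.
rewrite (@ge0_negligible_integral _ _ _ mu setT N)//; last 2 first.
- exact/measurable_EFinP.
- by move=> x _; rewrite lee_fin.
rewrite integral_mkcond; apply: ge0_le_integralT => x.
  by apply: erestrict_ge0 => y _; rewrite lee_fin.
rewrite /patch; case: ifPn => // /set_mem[_ Nx].
by apply: le_trans (hf x) _; apply: contrapT => fgx; apply: Nx; exact: fgN.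
Qed.

Lemma ae_ge0_eq_integralT (f g : T -> \bar R) :
  (forall x, 0 <= f x) -> (forall x, 0 <= g x) ->
  {ae mu, forall x, f x = g x} -> \int[mu]_x f x = \int[mu]_x g x.
Proof.
move=> f0 g0 fg; apply/eqP; rewrite eq_le; apply/andP; split;
  by apply: ae_ge0_le_integralT => //; apply: filterS fg => x ->.
Qed.

Lemma ae_eq_integralT (f g : T -> \bar R) :
  {ae mu, forall x, f x = g x} -> \int[mu]_x f x = \int[mu]_x g x.
Proof.
move=> fg; rewrite integralE [RHS]integralE; congr (_ - _);
  by apply: ae_ge0_eq_integralT => //; apply: filterS fg => x;
  rewrite ?funeposE ?funenegE => ->.
Qed.

End integral_complements.

Section borel.
Variables (R : realType).

Lemma open_borel (X : ptopologicalType) (A : set X) :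
  open A -> measurable (A : set (borel X)).
Proof. by move=> oA; exact: sub_sigma_algebra. Qed.

Lemma closed_borel (X : ptopologicalType) (A : set X) :
  closed A -> measurable (A : set (borel X)).
Proof.
move=> cA; rewrite -(setCK A); apply: measurableC; apply: open_borel.
exact: closed_openC.
Qed.

Lemma compact_borel (X : ptopologicalType) (A : set X) :
  hausdorff_space X -> compact A -> measurable (A : set (borel X)).
Proof. by move=> hX cA; apply: closed_borel; exact: compact_closed. Qed.

Lemma continuous_borel (X Y : ptopologicalType) (f : X -> Y) :
  continuous f -> measurable_fun setT (f : borel X -> borel Y).
Proof.
move=> /continuousP cf.
apply: (@measurability _ _ (borel X) (borel Y) setT f (@open Y)) => //.
by move=> _ [B oB <-]; rewrite setTI; apply: open_borel; exact: cf.
Qed.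

Lemma preimage_borel (X Y : ptopologicalType) (f : X -> Y) (A : set Y) :
  continuous f -> measurable (A : set (borel Y)) ->
  measurable (f @^-1` A : set (borel X)).
Proof.
by move=> /continuous_borel mf mA; rewrite -[X in measurable X]setTI; exact: mf.
Qed.

Lemma continuous_borel_realfun (X : ptopologicalType) (f : X -> R) :
  continuous f -> measurable_fun setT (f : borel X -> R).
Proof.
move=> /continuousP cf; apply: (measurability _ (RGenOpens.measurableE R)).
move=> _ [_ [a [b ->] <-]]; rewrite setTI; apply: open_borel.
exact/cf/interval_open.
Qed.

Lemma homeomorphism_image_borel (X Y : ptopologicalType) (f : X -> Y)
    (g : Y -> X) (A : set X) :
  continuous g -> cancel f g -> cancel g f ->
  measurable (A : set (borel X)) -> measurable (f @` A : set (borel Y)).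
Proof.
move=> cg fK gK mA; rewrite [X in measurable X](_ : _ = g @^-1` A).
  exact: preimage_borel.
apply/seteqP; split=> [_ [x Ax <-]|y Agy] /=; first by rewrite fK.
by exists (g y).
Qed.

End borel.

Section radon.
Context (R : realType) (X : ptopologicalType).
Variable mu : {measure set (borel X) -> \bar R}.
Hypotheses (hX : hausdorff_space X) (mu_reg : regular_borel mu).
Local Open Scope ereal_scope.

(** Outer approximation comes from inner regularity of U \ B: W is U minus a compact subset of U \ B
    that exhausts its measure up to e. *)
Lemma open_outer_approx (B U : set X) (e : R) :
  measurable (B : set (borel X)) -> open U -> B `<=` U -> mu U < +oo ->
  (0 < e)%R ->
  exists W : set X, [/\ open W, B `<=` W, W `<=` U & mu (W `\` B) <= e%:E].
Proof.
move=> mB oU BU Uoo e0.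
have mU := open_borel oU.
have mUB : measurable (U `\` B : set (borel X)) by exact: measurableD.
have UBoo : mu (U `\` B) \is a fin_num.
  rewrite ge0_fin_numE//; apply: le_lt_trans Uoo.
  by apply: le_measure; rewrite ?inE//; exact: subDsetl.
have := mu_reg.2 _ mUB => supE.
have : mu (U `\` B) - e%:E < mu (U `\` B) by rewrite lteBlDr// lteDl// lte_fin.
rewrite [X in _ < X]supE => /ereal_sup_gt[_ [C [cC CUB] <-]] CE.
have mC := compact_borel hX cC.
exists (U `\` C); split.
- by rewrite setDE; apply: openI => //; apply: closed_openC; exact: compact_closed.
- by move=> x Bx; split; [exact: BU|move=> /CUB[]].
- exact: subDsetl.
have -> : (U `\` C) `\` B = (U `\` B) `\` C by rewrite !setDDl setUC.
rewrite measureD//; last by rewrite -ge0_fin_numE.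
rewrite (setIidr CUB) leeBlDr; last first.
  rewrite ge0_fin_numE//; apply: le_lt_trans Uoo.
  by apply: le_measure; rewrite ?inE// => x /CUB[].
by rewrite addeC -leeBlDr//; exact: ltW.
Qed.

End radon.

(** * Comparison of lower integrals along a homeomorphism, with a density *)

Section transfer.
Context (R : realType) (X Y : ptopologicalType).
Variables (l1 : {measure set (borel X) -> \bar R}).
Variables (l2 : {measure set (borel Y) -> \bar R}).
Variables (T : X -> Y) (T' : Y -> X).
Hypotheses (hX : hausdorff_space X) (hY : hausdorff_space Y).
Hypotheses (cT : continuous T) (cT' : continuous T').
Hypotheses (TK : cancel T T') (T'K : cancel T' T).
Hypothesis l1_reg : regular_borel l1.
Variable v : Y -> R.
Hypotheses (cv : continuous v) (v0 : forall y, (0 < v y)%R).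
Local Open Scope ereal_scope.
Import HBNNSimple.

Let mv : measurable_fun setT (v : borel Y -> R).
Proof. exact: continuous_borel_realfun. Qed.

(** Inner regularity of [l1] carries the bound from compact to Borel sets, and summation carries it
    to simple functions. A simple function [h] below [g \o T] is transported to [h \o T'], which
    lies below [g]; so [g] itself need not be measurable. *)
Lemma transfer_compact :
  (forall C, compact C -> l1 C <= \int[l2]_(y in T @` C) (v y)%:E) ->
  forall g : Y -> \bar R, (forall y, 0 <= g y) ->
    \int[l1]_x g (T x) <= \int[l2]_y (g y * (v y)%:E).
Proof.
move=> hC g g0.
have hA (A : set (borel X)) : measurable A ->
    l1 A <= \int[l2]_(y in T @` A) (v y)%:E.
  move=> mA; rewrite (l1_reg.2 A mA); apply: ge_ereal_sup => _ [C [cC CA] <-].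
  apply: le_trans (hC C cC) _; apply: ge0_subset_integral => //.
  - by apply: (homeomorphism_image_borel cT' TK T'K); exact: compact_borel.
  - exact: (homeomorphism_image_borel cT' TK T'K).
  - by apply/measurable_EFinP; exact: measurable_funS mv.
  - by move=> y _; rewrite lee_fin ltW.
  - exact: image_subset.
apply: ge0_integral_le_nnsfun => [x //|h hg].
apply: (@le_trans _ _ (\int[l2]_y ((h (T' y))%:E * (v y)%:E))); last first.
  apply: ge0_le_integralT => y; first by rewrite mule_ge0// lee_fin// ltW.
  by rewrite lee_pmul2r ?fin_numE ?lte_fin//; rewrite -{2}(T'K y); exact: hg.
have mhT' r : measurable (T' @^-1` (h @^-1` [set r]) : set (borel Y)).
  exact: preimage_borel.
rewrite integralT_nnsfun sintegralE.
have -> : \int[l2]_y ((h (T' y))%:E * (v y)%:E) =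
    \int[l2]_y (\sum_(r \in range h)
      (r%:E * (\1_(h @^-1` [set r]) (T' y))%:E * (v y)%:E)).
  apply: eq_integral => y _; rewrite fimfunE -fsumEFin// ge0_mule_fsuml//.
  by move=> r; rewrite lee_fin; exact: nnfun_muleindic_ge0.
rewrite ge0_integral_fsum//; last 2 first.
- move=> r; apply: emeasurable_funM; last exact/measurable_EFinP.
  apply/measurable_EFinP; apply: measurable_funM => //.
  rewrite (_ : (fun _ => _) = \1_(T' @^-1` (h @^-1` [set r]))).
    exact: measurable_indic.
  by [].
- move=> r y _; apply: mule_ge0; first exact: nnfun_muleindic_ge0.
  by rewrite lee_fin ltW.
apply: lee_fsum => // r [x _ rE].
have r0 : (0 <= r)%R by rewrite -rE.
have -> : \int[l2]_y (r%:E * (\1_(h @^-1` [set r]) (T' y))%:E * (v y)%:E) =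
   r%:E * \int[l2]_(y in T @` (h @^-1` [set r])) (v y)%:E.
  rewrite [in RHS]integral_mkcond -ge0_integralZl//; last 2 first.
  - apply: (measurable_restrictT _ _).1.
      exact: (homeomorphism_image_borel cT' TK T'K).
    by apply/measurable_EFinP; exact: measurable_funS mv.
  - by move=> y _; apply: erestrict_ge0 => z _; rewrite lee_fin ltW.
  apply: eq_integral => y _; rewrite -muleA patchE; congr (_ * _).
  rewrite indicE; case: ifPn => [/set_mem[z hz <-]|yN].
    by rewrite mem_set ?mul1e//= TK.
  rewrite memNset ?mul0e//= => hy; move/negP: yN; apply; apply/mem_set.
  by exists (T' y).
by rewrite lee_wpmul2l ?lee_fin// hA.
Qed.

Hypothesis lcY : locally_compact [set: Y].
Hypothesis l2_reg : regular_borel l2.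

(** For compact C, let D = T(C) and take phi between the indicators of D and of an open W. Then phi
    v exceeds v 1_D only on W \ D, where v <= m, so that l2(W \ D) <= e / m costs at most e. The
    compact E provides the bound m and the finite measure needed for the outer approximation. *)
Lemma transfer_Cc :
  (forall phi : Y -> R, Cc phi -> (forall y, 0 <= phi y)%R ->
     \int[l1]_x (phi (T x))%:E <= \int[l2]_y (phi y * v y)%:E) ->
  forall g : Y -> \bar R, (forall y, 0 <= g y) ->
    \int[l1]_x g (T x) <= \int[l2]_y (g y * (v y)%:E).
Proof.
move=> hphi; apply: transfer_compact => C cC.
set D := T @` C.
have cD : compact D.
  by apply: continuous_compact => //; exact: continuous_subspaceT.
have [E cE DE] := compact_interior_cover lcY cD.
have [m m0 vm] : exists2 m : R, (0 < m)%R & forall y, E y -> (v y <= m)%R.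
  have [m m0 vm] := continuous_compact_bound cv cE.
  by exists m => // y Ey; apply: le_trans (vm y Ey); exact: ler_norm.
have mD := compact_borel hY cD.
have oE := @open_interior _ E.
have El2 : l2 E° < +oo.
  apply: le_lt_trans (l2_reg.1 E cE); apply: le_measure.
  - by rewrite inE; exact: open_borel.
  - by rewrite inE; exact: compact_borel.
  - exact: interior_subset.
apply/lee_addgt0Pr => e e0.
have [W [oW DW WE We]] :=
  open_outer_approx hY l2_reg mD oE DE El2 (divr_gt0 e0 m0).
have [phi [Ccphi phi01 phi1 phi0]] := urysohn_Cc R hY lcY cD oW DW.
have mWD : measurable (W `\` D : set (borel Y)).
  by apply: measurableD => //; exact: open_borel.
apply: (@le_trans _ _ (\int[l1]_x (phi (T x))%:E)).
  have -> : l1 C = \int[l1]_x (\1_C x)%:E.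
    by rewrite integral_indic ?setIT//; exact: compact_borel.
  apply: ge0_le_integralT => x; first by rewrite lee_fin.
  rewrite lee_fin indicE; have [Cx|_] := boolP (x \in C).
    by rewrite phi1//; exists x => //; exact: set_mem.
  by have /andP[] := phi01 (T x).
have phi0' y : (0 <= phi y)%R by have /andP[] := phi01 y.
apply: le_trans (hphi phi Ccphi phi0') _.
apply: (@le_trans _ _ (\int[l2]_y (((v \_ D) y)%:E +
    m%:E * (\1_(W `\` D) y)%:E))).
  apply: ge0_le_integralT => y; first by rewrite lee_fin mulr_ge0// ltW.
  rewrite lee_fin patchE indicE; have [/set_mem Dy|/negP Dy] := boolP (y \in D).
    by rewrite phi1// mul1r memNset ?mulr0 ?addr0//= => -[].
  rewrite add0r; have [Wy|Wy] := pselect (W y).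
    rewrite mem_set; last by split => // /mem_set.
    have /andP[_ phiy1] := phi01 y.
    rewrite mulr1; apply: (@le_trans _ _ (v y)); last first.
      by apply: vm; apply: interior_subset; exact: WE.
    by rewrite ler_piMl// ltW.
  by rewrite phi0// mul0r mulr_ge0// ltW.
have mvD : measurable_fun setT (v \_ D : borel Y -> R).
  by apply/(measurable_restrictT _ _).1 => //; exact: measurable_funS mv.
rewrite ge0_integralD//; last 4 first.
- by move=> y _; rewrite lee_fin; apply: restrict_ge0 => z _; rewrite ltW.
- exact/measurable_EFinP.
- by move=> y _; rewrite mule_ge0// lee_fin ltW.
- by apply: measurable_funeM; apply/measurable_EFinP; exact: measurable_indic.
rewrite [in leRHS]integral_mkcond.
have -> : \int[l2]_y ((v \_ D) y)%:E = \int[l2]_y ((EFin \o v) \_ D) y.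
  by apply: eq_integral => y _; rewrite !patchE; case: ifPn.
rewrite leeD2l// ge0_integralZl//; last 2 first.
- by apply/measurable_EFinP; exact: measurable_indic.
- by rewrite lee_fin ltW.
rewrite integral_indic ?setIT//.
apply: (@le_trans _ _ (m%:E * (e / m)%:E)).
  by rewrite lee_pmul2l ?lte_fin.
by rewrite -EFinM mulrC divfK// gt_eqF.
Qed.

End transfer.

Section compact_support.
Variable R : realType.

Lemma continuous_mulfun (X : topologicalType) (f g : X -> R) :
  continuous f -> continuous g -> continuous (fun x => f x * g x).
Proof. by move=> cf cg x; apply: cvgM; [exact: cf|exact: cg]. Qed.

Lemma continuous_invfun (X : topologicalType) (f : X -> R) :
  (forall x, f x != 0) -> continuous f -> continuous (fun x => (f x)^-1).
Proof. by move=> f0 cf x; apply: cvgV => //; exact: cf. Qed.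

Lemma Cc_compact_support (X : topologicalType) (f : X -> R) (D : set X) :
  hausdorff_space X -> continuous f -> compact D ->
  (forall x, ~ D x -> f x = 0) -> Cc f.
Proof.
move=> hX cf cD f0; split => //.
apply: (@subclosed_compact _ _ D) => //; first exact: closed_closure.
have clD : closed D by exact: compact_closed.
rewrite [X in _ `<=` X]((closure_id D).1 clD).
by apply: closureS => x /= fx; apply: contrapT => /f0 fx0; rewrite fx0 eqxx in fx.
Qed.

Lemma CcP0 (X : topologicalType) (f : X -> R) :
  forall x, ~ closure [set x | f x != 0] x -> f x = 0.
Proof.
move=> x fx; apply: contrapT => /eqP fx0; apply: fx; exact: subset_closure.
Qed.

Lemma Cc_bounded (X : topologicalType) (f : X -> R) : Cc f ->
  exists2 M : R, 0 < M & forall x, `|f x| <= M.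
Proof.
move=> [cf cS].
have [M M0 fM] := continuous_compact_bound cf cS; exists M => // x.
have [Sx|Sx] := pselect (closure [set x | f x != 0] x); first exact: fM.
by rewrite (CcP0 Sx) normr0 ltW.
Qed.

Lemma Cc_mul (X : topologicalType) (f w : X -> R) :
  hausdorff_space X -> Cc f -> continuous w -> Cc (fun x => f x * w x).
Proof.
move=> hX [cf cS] cw; apply: (Cc_compact_support hX _ cS) => [x|x /CcP0 ->].
  by apply: cvgM; [exact: cf|exact: cw].
by rewrite mul0r.
Qed.

Lemma Cc_comp (X Y : topologicalType) (f : Y -> R) (T : X -> Y) (T' : Y -> X) :
  hausdorff_space X -> continuous T -> continuous T' ->
  cancel T T' -> Cc f -> Cc (f \o T).
Proof.
move=> hX cT cT' TK [cf cS].
apply: (@Cc_compact_support _ _ (T' @` closure [set x | f x != 0])) => //.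
- by move=> x; apply: continuous_comp; [exact: cT|exact: cf].
- by apply: continuous_compact => //; exact: continuous_subspaceT.
move=> x Sx; apply: (CcP0 (x := T x)) => STx; apply: Sx; exists (T x) => //.
Qed.

Lemma Cc_integral_lty (X : ptopologicalType)
    (mu : {measure set (borel X) -> \bar R}) (f : X -> R) :
  hausdorff_space X -> (forall C : set X, compact C -> (mu C < +oo)%E) ->
  Cc f -> (forall x, 0 <= f x) -> (\int[mu]_x (f x)%:E < +oo)%E.
Proof.
move=> hX mufin Ccf f0; have [M M0 fM] := Cc_bounded Ccf.
set S := closure [set x | f x != 0].
have cS : compact S by case: Ccf.
have mS := compact_borel hX cS.
apply: (@le_lt_trans _ _ (\int[mu]_x (M%:E * (\1_S x)%:E))%E).
  apply: ge0_le_integralT => x; first by rewrite lee_fin.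
  rewrite lee_fin indicE; have [Sx|/negP Sx] := boolP (x \in S).
    by rewrite mulr1; apply: le_trans (fM x); exact: ler_norm.
  by rewrite mulr0 (CcP0 (x := x))// => /mem_set.
rewrite ge0_integralZl//; last 2 first.
- by apply/measurable_EFinP; exact: measurable_indic.
- by rewrite lee_fin ltW.
rewrite integral_indic// setIT lte_mul_pinfty ?lee_fin ?ltW//.
exact: mufin.
Qed.

End compact_support.

(** * Exchange of integrals for functions of compact support *)

Section fubini_Cc.
Context (R : realType) (X Y : ptopologicalType).
Hypotheses (hX : hausdorff_space X) (hY : hausdorff_space Y).

(** Finitely many open rectangles inside U cover C, and their union lies in the product
    sigma-algebra. *)
Lemma compact_open_rectangles (C U : set (X * Y)) :
  compact C -> open U -> C `<=` U ->
  exists M : set (X * Y),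
    [/\ measurable (M : set (borel X * borel Y)), C `<=` M & M `<=` U].
Proof.
move=> cC oU CU.
have rect (z : X * Y) : exists AB : set X * set Y,
    C z -> [/\ open AB.1, open AB.2, AB.1 z.1, AB.2 z.2 & AB.1 `*` AB.2 `<=` U].
  have [Cz|] := pselect (C z); last by exists (set0, set0).
  have : nbhs z U by apply: open_nbhs_nbhs; split => //; exact: CU.
  move=> [[A B] /= [Az Bz] ABU].
  exists (A°, B°) => _; split => /=; try exact: open_interior.
  - exact: Az.
  - exact: Bz.
  - by move=> [x y] /= [/interior_subset Ax /interior_subset By]; exact: ABU.
pose AB z := projT1 (cid (rect z)).
have ABP z : C z -> [/\ open (AB z).1, open (AB z).2, (AB z).1 z.1, (AB z).2 z.2 &
    (AB z).1 `*` (AB z).2 `<=` U] by exact: (projT2 (cid (rect z))).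
case: (@compact_fset_cover _ C (X * Y)%type C
    (fun z => (AB z).1 `*` (AB z).2) cC) => [z Cz|z Cz|D DC CD].
- have [oA oB _ _ _] := ABP z Cz; rewrite openE => -[x y] [/= Ax By].
  exists ((AB z).1, (AB z).2) => //=.
  by split; exact: open_nbhs_nbhs.
- by exists z => //; have [_ _ ? ? _] := ABP z Cz.
exists (\bigcup_(z in [set` D]) ((AB z).1 `*` (AB z).2)); split => //.
- apply: fin_bigcup_measurable => // z zD.
  have [oA oB _ _ _] := ABP z (set_mem (DC _ zD)).
  by apply: measurableX; exact: open_borel.
- move=> x [z zD zx].
  by have [_ _ _ _ ABU] := ABP z (set_mem (DC _ zD)); exact: ABU.
Qed.

(* The Borel sigma-algebra of X * Y may be larger than the product of the Borel
   sigma-algebras; but the sets [f > a], being open and sigma-compact, belong to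
   the latter. *)
Lemma Cc_measurable_prod (f : X * Y -> R) : Cc f -> (forall z, 0 <= f z) ->
  measurable_fun setT (f : borel X * borel Y -> R).
Proof.
move=> [cf cS] f0; apply: (measurability _ (RGenOInfty.measurableE R)).
move=> _ [_ [a ->] <-]; rewrite setTI preimage_itvoy.
have [a0|a0] := ltP a 0.
  rewrite [X in measurable X](_ : _ = setT)//; apply/seteqP; split => // z _ /=.
  exact: lt_le_trans a0 (f0 z).
have oU : open [set z | a < f z].
  exact: (open_comp (fun z _ => cf z) (@open_gt R a)).
(* As a >= 0, f does not vanish on this closed set, which therefore lies in the support. *)
have cU n : compact [set z | a + n.+1%:R^-1 <= f z].
  apply: (subclosed_compact _ cS).
    exact: (preimage_closed (fun z _ => cf z) (@closed_ge R (a + n.+1%:R^-1))).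
  move=> z /= fz; apply: subset_closure => /=; rewrite gt_eqF//.
  by apply: lt_le_trans fz; rewrite ltr_wpDl.
have UU n : [set z | a + n.+1%:R^-1 <= f z] `<=` [set z | a < f z].
  by move=> z /=; apply: lt_le_trans; rewrite ltrDl invr_gt0.
pose M n := projT1 (cid (compact_open_rectangles (cU n) oU (@UU n))).
have MP n : [/\ measurable (M n : set (borel X * borel Y)),
    [set z | a + n.+1%:R^-1 <= f z] `<=` M n & M n `<=` [set z | a < f z]].
  exact: (projT2 (cid (compact_open_rectangles (cU n) oU (@UU n)))).
rewrite [X in measurable X](_ : _ = \bigcup_n M n); last first.
  apply/seteqP; split => [z /= az|z [n _ Mz]]; last first.
    by have [_ _] := MP n; exact.
  have [n /ltW an] : exists n, n.+1%:R^-1 < f z - a.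
    by have := ltr_add_invr az => -[k]; exists k; rewrite ltrBrDl.
  exists n => //; have [_ MU _] := MP n; apply: MU => /=.
  by rewrite -lerBrDl.
by apply: bigcup_measurable => n _; have [] := MP n.
Qed.

Variables (m1 : {measure set (borel X) -> \bar R}).
Variables (m2 : {measure set (borel Y) -> \bar R}).
Hypothesis m1fin : forall C : set X, compact C -> (m1 C < +oo)%E.
Hypothesis m2fin : forall C : set Y, compact C -> (m2 C < +oo)%E.
Local Open Scope ereal_scope.

Lemma integral_mfrestr d (T : measurableType d)
    (m : {measure set T -> \bar R}) (A : set T) (mA : measurable A)
    (Aoo : m A < +oo) (g : T -> \bar R) :
  (forall x, ~ A x -> g x = 0) ->
  \int[m]_x g x = \int[mfrestr mA Aoo]_x g x.
Proof.
move=> gA; have gE : g = g \_ A.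
  apply/funext => x; rewrite patchE; case: ifPn => // /negP xA.
  by apply: gA => /mem_set.
rewrite gE -!integral_mkcond; apply: eq_measure_integral => B mB BA.
by rewrite /= /mfrestr /mrestr setIidl.
Qed.

(** Restricting both measures to the projections of the support makes them finite without changing
    the integrals, so Tonelli's theorem applies. *)
Lemma fubini_Cc (f : X * Y -> R) : Cc f -> (forall z, 0 <= f z)%R ->
  \int[m1]_x \int[m2]_y (f (x, y))%:E = \int[m2]_y \int[m1]_x (f (x, y))%:E.
Proof.
move=> Ccf f0; set S := closure [set z | (f z != 0)%R].
have cS : compact S by case: Ccf.
have cA : compact (fst @` S).
  by apply: continuous_compact => //; apply: continuous_subspaceT => z; exact: cvg_fst.
have cB : compact (snd @` S).
  by apply: continuous_compact => //; apply: continuous_subspaceT => z; exact: cvg_snd.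
have fA x y : ~ (fst @` S) x -> f (x, y) = 0%R.
  by move=> Ax; apply: CcP0 => Sxy; apply: Ax; exists (x, y).
have fB x y : ~ (snd @` S) y -> f (x, y) = 0%R.
  by move=> By; apply: CcP0 => Sxy; apply: By; exists (x, y).
pose n1 := mfrestr (compact_borel hX cA) (m1fin cA).
pose n2 := mfrestr (compact_borel hY cB) (m2fin cB).
have E1 y : \int[m1]_x (f (x, y))%:E = \int[n1]_x (f (x, y))%:E.
  by apply: integral_mfrestr => x Ax; rewrite fA.
have E2 x : \int[m2]_y (f (x, y))%:E = \int[n2]_y (f (x, y))%:E.
  by apply: integral_mfrestr => y By; rewrite fB.
under eq_integral do rewrite E2; under [RHS]eq_integral do rewrite E1.
rewrite (integral_mfrestr (compact_borel hX cA) (m1fin cA)); last first.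
  by move=> x Ax; apply: integral0_eq => y _; rewrite fA.
rewrite (integral_mfrestr (compact_borel hY cB) (m2fin cB)); last first.
  by move=> y By; apply: integral0_eq => x _; rewrite fB.
apply: (@fubini_tonelli _ _ _ _ _ n1 n2 (fun z => (f z)%:E)).
  by apply/measurable_EFinP; exact: Cc_measurable_prod.
by move=> z; rewrite lee_fin.
Qed.

End fubini_Cc.

(** * Uniqueness of Haar measure *)

Section topological_group.
Variable G : topGroupType.

Lemma continuous_mulg (T : topologicalType) (f g : T -> G) :
  continuous f -> continuous g -> continuous (fun t => f t * g t)%g.
Proof.
move=> cf cg t.
apply: (@continuous2_cvg _ _ _ _ _ _ f g (fun u v => u * v)%g).
- exact: (@mulg_continuous G (f t, g t)).
- exact: cf.
- exact: cg.
Qed.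

Lemma continuous_invg (T : topologicalType) (f : T -> G) :
  continuous f -> continuous (fun t => (f t)^-1)%g.
Proof.
by move=> cf t; apply: continuous_comp; [exact: cf|exact: invg_continuous].
Qed.

Lemma continuous_mulgl (x : G) : continuous (fun y : G => (x * y)%g).
Proof. by apply: (@continuous_mulg _ (fun=> x) id) => y; [exact: cvg_cst|]. Qed.

Lemma continuous_mulgr (x : G) : continuous (fun y : G => (y * x)%g).
Proof. by apply: (@continuous_mulg _ id (fun=> x)) => y; [|exact: cvg_cst]. Qed.

Lemma continuous_image_compact (X Y : topologicalType) (f : X -> Y) (C : set X) :
  continuous f -> compact C -> compact (f @` C).
Proof. by move=> cf; apply: continuous_compact; exact: continuous_subspaceT. Qed.

Lemma compact_mulg (A B : set G) : compact A -> compact B ->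
  compact [set (a * b)%g | a in A & b in B].
Proof.
move=> cA cB.
have := compact_setX cA cB => /(continuous_image_compact (@mulg_continuous G)).
congr compact; apply/seteqP; split => [_ [[a b] [/= Aa Bb] <-]|_ [a Aa [b Bb <-]]].
  by exists a => //; exists b.
by exists (a, b).
Qed.

Lemma open_mulg_image (x : G) (A : set G) : open A ->
  open [set (x * y)%g | y in A].
Proof.
move=> oA; rewrite [X in open X](_ : _ = (fun y : G => (x^-1 * y)%g) @^-1` A).
  by apply: open_comp => // y _; exact: continuous_mulgl.
apply/seteqP; split => [_ [y Ay <-]|y /= Ay]; first by rewrite /= mulKg.
by exists (x^-1 * y)%g => //; rewrite mulVKg.
Qed.

End topological_group.

Section haar.
Context (R : realType) (G : topGroupType).
Hypotheses (hG : hausdorff_space G) (lcG : locally_compact [set: G]).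
Variable mu : {measure set (borel G) -> \bar R}.
Hypothesis haar : left_haar mu.

Let mufin (C : set G) : compact C -> (mu C < +oo)%E.
Proof. by case: haar => -[+ _] _ _; exact. Qed.

(** One inequality for all translations suffices: the reverse one is the same inequality for
    x^-1. *)
Lemma left_haar_integral (x : G) (g : G -> \bar R) : (forall y, 0 <= g y)%E ->
  (\int[mu]_y g (x * y)%g = \int[mu]_y g y)%E.
Proof.
move=> g0; have [reg _ inv] := haar.
have le z (k : G -> \bar R) : (forall y, 0 <= k y)%E ->
    (\int[mu]_y k (z * y)%g <= \int[mu]_y k y)%E.
  move=> k0.
  have := @transfer_compact R G G mu mu (fun y => z * y)%g (fun y => z^-1 * y)%g
    hG (@continuous_mulgl _ _) (@mulKg _ z) (@mulVKg _ z) reg (fun=> 1)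
    (@cst_continuous G R 1) (fun=> ltr01).
  move/(_ _ k k0) => H; apply: (le_trans (H _)).
    move=> C cC; rewrite integral_cst ?mul1e//=; last first.
      apply: compact_borel => //; apply: continuous_image_compact cC.
      exact: continuous_mulgl.
    by rewrite inv//; exact: compact_borel.
  by under eq_integral do rewrite mule1.
apply/eqP; rewrite eq_le le//=.
rewrite [X in (X <= _)%E](_ : _ =
    \int[mu]_y (fun y => g (x * y)%g) (x^-1 * y)%g)%E.
  exact: le.
by apply: eq_integral => y _; rewrite mulVKg.
Qed.

(** Finitely many translates of A cover a given compact set. If A were null, so would be every
    compact set, and then G itself by inner regularity. *)
Lemma open_haar_gt0 (A : set G) : open A -> A !=set0 -> (0 < mu A)%E.
Proof.
move=> oA [a Aa]; have [[_ reg] muT inv] := haar.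
rewrite lt0e measure_ge0 andbT; apply/negP => /eqP A0.
move/eqP: muT; apply; rewrite reg//; apply/eqP; rewrite eq_le; apply/andP; split.
  apply: ge_ereal_sup => _ [C [cC _] <-].
  pose F (x : G) := [set (x * y)%g | y in A].
  have [i _|x Cx|D _ CD] := @compact_fset_cover G C G setT F cC.
  - exact: open_mulg_image.
  - by exists (x * a^-1)%g => //; exists a => //; rewrite mulgVK.
  have : mu.-negligible (\bigcup_(i in [set` D]) F i).
    rewrite -bigsetU_fset_set// set_fsetK.
    elim/big_ind : _ => //; first exact: negligible_set0.
      exact: (@negligibleU _ (borel G) R mu).
    move=> x _; have oF : open (F x) by exact: open_mulg_image.
    apply/(negligibleP _ (open_borel oF)).
    by rewrite -A0; exact: (inv x A (open_borel oA)).
  move/(@negligibleS _ (borel G) R mu _ _ CD).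
  by move/(measure_negligible (compact_borel hG cC)) => /= ->.
apply: ereal_sup_ubound; exists set0; first by split => //; exact: compact0.
by rewrite measure0.
Qed.

Lemma haar_integral_gt0 (f : G -> R) (a : G) :
  continuous f -> (forall x, 0 <= f x) -> 0 < f a ->
  (0 < \int[mu]_x (f x)%:E)%E.
Proof.
move=> cf f0 fa; pose r := f a / 2.
have r0 : 0 < r by rewrite divr_gt0.
pose U := [set x | r < f x].
have oU : open U by exact: (open_comp (fun z _ => cf z) (@open_gt R r)).
have U0 : U !=set0 by exists a; rewrite /U /= ltr_pdivrMr// ltr_pMr// ltr1n.
apply: (@lt_le_trans _ _ (r%:E * mu U)%E).
  by rewrite mule_gt0 ?lte_fin//; exact: open_haar_gt0.
have -> : mu U = (\int[mu]_x (\1_U x)%:E)%E.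
  by rewrite integral_indic ?setIT//; exact: open_borel.
rewrite -ge0_integralZl//; last 2 first.
- by apply/measurable_EFinP; apply: measurable_indic; exact: open_borel.
- by rewrite lee_fin ltW.
apply: ge0_le_integralT => x; first by rewrite -EFinM lee_fin mulr_ge0// ltW.
rewrite -EFinM lee_fin indicE; have [/set_mem/ltW/=|_] := boolP (_ \in _).
  by rewrite mulr1.
by rewrite mulr0.
Qed.

Lemma Cc_bump (N : set G) : nbhs 1%g N ->
  exists g : G -> R, [/\ Cc g, forall x, 0 <= g x, forall x, ~ N x -> g x = 0
    & 0 < g 1%g].
Proof.
move=> N1.
have sub1 : [set 1%g] `<=` N° by move=> _ ->.
have [g [Ccg g01 g1 g0]] := urysohn_Cc R hG lcG (@compact_set1 _ 1%g)
  (@open_interior _ N) sub1.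
exists g; split => //.
- by move=> x; have /andP[] := g01 x.
- by move=> x Nx; apply: g0 => /interior_subset.
- by rewrite g1.
Qed.

(** * Uniqueness for a measure [lam] with a continuous weight [w] *)

Variable lam : {measure set (borel G) -> \bar R}.
Hypothesis lamfin : forall C : set G, compact C -> (lam C < +oo)%E.
Variable w : G -> R.
Hypotheses (cw : continuous w) (w0 : forall x, 0 <= w x).
Hypothesis lam_inv : forall (x : G) (f : G -> R), Cc f -> (forall y, 0 <= f y) ->
  (\int[lam]_y (f (x * y)%g * w y)%:E = \int[lam]_y (f y * w y)%:E)%E.
Let Imu (f : G -> R) := (\int[mu]_x (f x)%:E)%E.
Let Jlam (f : G -> R) := (\int[lam]_x (f x * w x)%:E)%E.
Let Jinv (x : G) (f : G -> R) : Cc f -> (forall y, 0 <= f y) ->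
  Jlam (fun y => f (x * y)%g) = Jlam f.
Proof. exact: lam_inv. Qed.

Let S (f : G -> R) := closure [set x | f x != 0].

Let Jfin f : Cc f -> (forall y, 0 <= f y) -> Jlam f \is a fin_num.
Proof.
move=> Ccf f0; rewrite ge0_fin_numE; last first.
  by apply: integral_ge0 => x _; rewrite lee_fin mulr_ge0.
apply: Cc_integral_lty => //; first exact: Cc_mul.
by move=> x; rewrite mulr_ge0.
Qed.

Let Ifin f : Cc f -> (forall y, 0 <= f y) -> Imu f \is a fin_num.
Proof.
move=> Ccf f0; rewrite ge0_fin_numE; last first.
  by apply: integral_ge0 => x _; rewrite lee_fin.
exact: Cc_integral_lty.
Qed.

Let mw (f : G -> R) : continuous f ->
  measurable_fun setT (fun x : borel G => (f x)%:E).
Proof. by move=> cf; apply/measurable_EFinP; exact: continuous_borel_realfun. Qed.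

Let cinv (g : G -> R) : Cc g -> Cc (fun y => g y^-1)%g.
Proof.
by apply: (@Cc_comp _ _ _ g (fun y => y^-1)%g (fun y => y^-1)%g) => //;
  [exact: invg_continuous|exact: invg_continuous|exact: invgK].
Qed.

Let crmul (g : G -> R) x : Cc g -> Cc (fun y => g (y * x))%g.
Proof.
by apply: (@Cc_comp _ _ _ g (fun y => y * x)%g (fun y => y * x^-1)%g) => //;
  [exact: continuous_mulgr|exact: continuous_mulgr|exact: mulgK].
Qed.

Let hGG : hausdorff_space (G * G)%type.
Proof.
move=> [x1 x2] [y1 y2] cl; congr pair; apply: hG => A B Ax By.
  have [] := cl (A `*` setT) (B `*` setT).
  - by exists (A, setT) => //=; split => //; exact: filterT.
  - by exists (B, setT) => //=; split => //; exact: filterT.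
  by move=> [z1 z2] [[/= Az _] [Bz _]]; exists z1.
have [] := cl (setT `*` A) (setT `*` B).
- by exists (setT, A) => //=; split => //; exact: filterT.
- by exists (setT, B) => //=; split => //; exact: filterT.
by move=> [z1 z2] [[/= _ Az] [_ Bz]]; exists z2.
Qed.

Let cfst : continuous (fst : G * G -> G). Proof. by move=> z; exact: cvg_fst. Qed.
Let csnd : continuous (snd : G * G -> G). Proof. by move=> z; exact: cvg_snd. Qed.

Let ccomp (T : topologicalType) (h : T -> G) (f : G -> R) :
  continuous f -> continuous h -> continuous (fun t => f (h t)).
Proof. by move=> cf ch t; apply: continuous_comp; [exact: ch|exact: cf]. Qed.

(* Both sides are the integral of f(x) g(y^-1 x) w(y) over G * G. *)
Let haar_double_integral f g : Cc f -> Cc g ->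
  (forall x, 0 <= f x) -> (forall x, 0 <= g x) ->
  (Imu f * Jlam (fun y => g y^-1%g) =
   \int[mu]_x ((g x)%:E * Jlam (fun y => f (y * x)%g)))%E.
Proof.
move=> Ccf Ccg f0 g0.
have [cf cSf] := Ccf; have [cg cSg] := Ccg.
(* If f(x) g(y^-1 x) is nonzero, then y = x (y^-1 x)^-1 lies in D; if f(yx) g(x) is nonzero, then y
   = (yx) x^-1 does too. One compact set thus bounds y in both double integrals. *)
have cD : compact [set (a * b)%g | a in S f & b in [set x^-1%g | x in S g]].
  apply: compact_mulg => //; apply: continuous_image_compact cSg.
  exact: invg_continuous.
set D := [set _ | _ in _ & _ in _] in cD.
have step1 : (Imu f * Jlam (fun y => g y^-1%g) =
    \int[mu]_x \int[lam]_y (f x * g (y^-1 * x)%g * w y)%:E)%E.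
  rewrite -ge0_integralZr//; last 3 first.
  - exact: mw.
  - by move=> x _; rewrite lee_fin.
  - by apply: integral_ge0 => x _; rewrite lee_fin mulr_ge0.
  apply: eq_integral => x _.
  rewrite -(@Jinv x^-1%g (fun y => g y^-1%g))//; last exact: cinv.
  rewrite -ge0_integralZl//; last 3 first.
  - apply: mw => y; apply: cvgM; last exact: cw.
    exact: (ccomp cg (continuous_invg (@continuous_mulgl _ x^-1%g))).
  - by move=> y _; rewrite lee_fin mulr_ge0.
  - by rewrite lee_fin.
  by apply: eq_integral => y _; rewrite -EFinM invgM invgK mulrA.
have step2 : (\int[mu]_x \int[lam]_y (f x * g (y^-1 * x)%g * w y)%:E =
    \int[lam]_y \int[mu]_x (f x * g (y^-1 * x)%g * w y)%:E)%E.
  apply: (@fubini_Cc R G G hG hG mu lam mufin lamfin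
    (fun z => f z.1 * g (z.2^-1 * z.1)%g * w z.2)); last first.
    by move=> z; rewrite !mulr_ge0.
  apply: (Cc_compact_support hGG _ (compact_setX cSf cD)).
    move=> z; apply: cvgM; last exact: (ccomp cw csnd).
    apply: cvgM; first exact: (ccomp cf cfst).
    exact: (ccomp cg (continuous_mulg (continuous_invg csnd) cfst)).
  move=> [x y] /= /not_andP[Sx|Dy].
    by rewrite (CcP0 Sx) !mul0r.
  have [Sx|Sx] := pselect (S f x); last by rewrite (CcP0 Sx) !mul0r.
  rewrite (CcP0 (f := g)) ?mulr0 ?mul0r// => Sg; apply: Dy.
  exists x => //; exists (y^-1 * x)^-1%g; first by exists (y^-1 * x)%g.
  by rewrite invgM invgK mulVKg.
have step3 : (\int[lam]_y \int[mu]_x (f x * g (y^-1 * x)%g * w y)%:E =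
    \int[lam]_y \int[mu]_x (f (y * x)%g * g x * w y)%:E)%E.
  apply: eq_integral => y _.
  rewrite -(@left_haar_integral y); last by move=> x; rewrite lee_fin !mulr_ge0.
  by apply: eq_integral => x _; rewrite mulKg.
have step4 : (\int[mu]_x \int[lam]_y (f (y * x)%g * g x * w y)%:E =
    \int[lam]_y \int[mu]_x (f (y * x)%g * g x * w y)%:E)%E.
  apply: (@fubini_Cc R G G hG hG mu lam mufin lamfin
    (fun z => f (z.2 * z.1)%g * g z.1 * w z.2)); last first.
    by move=> z; rewrite !mulr_ge0.
  apply: (Cc_compact_support hGG _ (compact_setX cSg cD)).
    move=> z; apply: cvgM; last exact: (ccomp cw csnd).
    apply: cvgM; last exact: (ccomp cg cfst).
    exact: (ccomp cf (continuous_mulg csnd cfst)).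
  move=> [x y] /= /not_andP[Sx|Dy].
    by rewrite (CcP0 Sx) mulr0 mul0r.
  have [Sx|Sx] := pselect (S g x); last by rewrite (CcP0 Sx) mulr0 mul0r.
  rewrite (CcP0 (f := f)) ?mul0r// => Sf; apply: Dy.
  exists (y * x)%g => //; exists x^-1%g; first by exists x.
  by rewrite mulgK.
rewrite step1 step2 step3 -step4; apply: eq_integral => x _.
rewrite -[RHS]ge0_integralZl//; last 3 first.
- apply: mw => y; apply: cvgM; last exact: cw.
  exact: (ccomp cf (@continuous_mulgr _ x)).
- by move=> y _; rewrite lee_fin mulr_ge0.
- by rewrite lee_fin.
by apply: eq_integral => y _; rewrite -EFinM mulrA (mulrC (g x)).
Qed.

(** As x tends to 1, f(yx) tends to f(y) uniformly in y on compact sets. For x in the fixed compact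
    neighborhood C0 all these functions vanish off the compact E; since m bounds the integral of w
    over E, a uniform error of e / m suffices. *)
Let near_right_translate f (e : R) : Cc f -> (forall x, 0 <= f x) -> 0 < e ->
  \forall x \near (1%g : G), (Jlam (fun y => f (y * x)%g) <= Jlam f + e%:E)%E /\
    (Jlam f <= Jlam (fun y => f (y * x)%g) + e%:E)%E.
Proof.
move=> Ccf f0 e0; have [cf cSf] := Ccf.
have [C0 + [cC0 _]] := lcG (I : setT (1%g : G)); rewrite withinET => C01.
set E := S f `|` [set (a * b)%g | a in S f & b in [set x^-1%g | x in C0]].
have cE : compact E.
  apply: compactU => //; apply: compact_mulg => //.
  by apply: continuous_image_compact cC0; exact: invg_continuous.
have mE := compact_borel hG cE.
have [m m0 mP] : exists2 m : R, 0 < m &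
    (\int[lam]_y (\1_E y * w y)%:E <= m%:E)%E.
  have [M M0 wM] := continuous_compact_bound cw cE.
  have Efin : lam E \is a fin_num by rewrite ge0_fin_numE//; exact: lamfin.
  (* The summand 1 keeps m positive when E is null. *)
  exists (M * fine (lam E) + 1).
    by rewrite ltr_wpDl// mulr_ge0 ?fine_ge0// ltW.
  apply: (@le_trans _ _ (\int[lam]_y (M%:E * (\1_E y)%:E))%E).
    apply: ge0_le_integralT => y; first by rewrite lee_fin mulr_ge0.
    rewrite -EFinM lee_fin indicE; have [/set_mem Ey|_] := boolP (y \in E).
      by rewrite mulr1 mul1r; apply: le_trans (wM y Ey); exact: ler_norm.
    by rewrite mul0r mulr0.
  rewrite ge0_integralZl//; last 2 first.
  - by apply/measurable_EFinP; exact: measurable_indic.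
  - by rewrite lee_fin ltW.
  rewrite integral_indic// setIT EFinD EFinM fineK// leeDl// lee_fin.
have near_unif : \forall x \near (1%g : G),
    E `<=` (fun y => `|f (y * x)%g - f y| < e / m).
  have /compact_near_coveringP := cE.
  apply; move=> y _.
  have cF : continuous (fun z : G * G => f (z.1 * z.2)%g - f z.1).
    move=> z; apply: cvgB; last exact: (ccomp cf cfst).
    exact: (ccomp cf (continuous_mulg cfst csnd)).
  have := cF (y, 1%g); rewrite /continuous_at /= mulg1 subrr => /cvgr0_norm_lt.
  by apply; rewrite divr_gt0.
have bound (p q : G -> R) : Cc p -> Cc q ->
    (forall y, 0 <= p y) -> (forall y, 0 <= q y) ->
    (forall y, p y <= q y + e / m * \1_E y) -> (Jlam p <= Jlam q + e%:E)%E.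
  move=> Ccp Ccq p0 q0 pq.
  have em0 : 0 <= e / m by rewrite divr_ge0// ltW.
  have mi : measurable_fun setT (fun y : borel G => (\1_E y * w y)%:E).
    apply/measurable_EFinP; apply: measurable_funM; first exact: measurable_indic.
    exact: continuous_borel_realfun.
  apply: (@le_trans _ _ (\int[lam]_y
      ((q y * w y)%:E + (e / m)%:E * (\1_E y * w y)%:E))%E).
    apply: ge0_le_integralT => y; first by rewrite lee_fin mulr_ge0.
    by rewrite -EFinM -EFinD lee_fin mulrA -mulrDl ler_wpM2r.
  rewrite ge0_integralD//; last 4 first.
  - by move=> y _; rewrite lee_fin mulr_ge0.
  - by apply: mw => y; apply: cvgM; [exact: Ccq.1|exact: cw].
  - by move=> y _; rewrite mule_ge0// lee_fin ?mulr_ge0.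
  - exact: measurable_funeM.
  rewrite leeD2l// ge0_integralZl//; last first.
    by move=> y _; rewrite lee_fin mulr_ge0.
  apply: (@le_trans _ _ ((e / m)%:E * m%:E)%E).
    by rewrite lee_wpmul2l// lee_fin.
  by rewrite -EFinM divfK// gt_eqF.
near=> x.
have unif : E `<=` (fun y => `|f (y * x)%g - f y| < e / m).
  by near: x.
have Cx : C0 x by near: x.
have fE y : ~ E y -> f y = 0 /\ f (y * x)%g = 0.
  move=> Ey; split; first by apply: CcP0 => Sy; apply: Ey; left.
  apply: CcP0 => Sy; apply: Ey; right; exists (y * x)%g => //.
  by exists x^-1%g; [exists x|rewrite mulgK].
have fx y : `|f (y * x)%g - f y| <= e / m * \1_E y.
  rewrite indicE; have [/set_mem Ey|/negP Ey] := boolP (y \in E).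
    by rewrite mulr1 ltW//; exact: unif.
  have [|-> ->] := @fE y; first by move/mem_set.
  by rewrite subrr normr0 mulr0.
have Ccfx := crmul x Ccf.
split; apply: bound => // y; have := fx y; rewrite ler_norml => /andP[fx1 fx2].
  by rewrite -lerBlDl.
by rewrite -lerBlDl -opprB lerNl.
Unshelve. all: by end_near. Qed.

(* As the support of g shrinks to 1, haar_double_integral shows that
   (Jlam f) / (Imu f) is the limit of a ratio that does not depend on f. *)
Theorem haar_unique : exists2 c : R, 0 <= c &
  forall f : G -> R, Cc f -> (forall x, 0 <= f x) ->
    (\int[lam]_x (f x * w x)%:E = c%:E * \int[mu]_x (f x)%:E)%E.
Proof.
have cross f1 f2 : Cc f1 -> Cc f2 -> (forall x, 0 <= f1 x) ->
    (forall x, 0 <= f2 x) ->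
    fine (Jlam f1) * fine (Imu f2) = fine (Jlam f2) * fine (Imu f1).
  move=> Cf1 Cf2 f10 f20.
  suff le e : 0 < e ->
      `|fine (Jlam f1) * fine (Imu f2) - fine (Jlam f2) * fine (Imu f1)| <=
      e * (fine (Imu f1) + fine (Imu f2)).
    apply/eqP; rewrite -subr_eq0 -normr_le0; apply/ler_addgt0Pl => e e0.
    rewrite addr0.
    have s0 : 0 < fine (Imu f1) + fine (Imu f2) + 1.
      rewrite ltr_wpDl// addr_ge0// fine_ge0// integral_ge0// => x _;
        by rewrite lee_fin.
    apply: le_trans (le (e / (fine (Imu f1) + fine (Imu f2) + 1)) (divr_gt0 e0 s0)) _.
    by rewrite mulrAC ler_pdivrMr// ler_pM2l// lerDl.
  move=> e0.
  have N1 := near_right_translate Cf1 f10 e0.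
  have N2 := near_right_translate Cf2 f20 e0.
  (* One g, supported where the translation estimates hold for both f1 and f2. *)
  have [g [Ccg g0 gN g1]] := Cc_bump (filterI N1 N2).
  have gI := haar_integral_gt0 Ccg.1 g0 g1.
  have fingI := Ifin Ccg g0.
  pose j := fine (Jlam (fun y => g y^-1%g)).
  have Ccg' := cinv Ccg.
  have jE : Jlam (fun y => g y^-1%g) = j%:E by rewrite fineK// Jfin.
  pose i := fine (Imu g).
  have iE : Imu g = i%:E by rewrite fineK.
  have i0 : 0 < i by rewrite -lte_fin -iE.
  have mg : measurable_fun setT (fun x : borel G => (g x)%:E) by exact: mw Ccg.1.
  have gc (c : R) : 0 <= c -> (\int[mu]_x ((g x)%:E * c%:E) = (i * c)%:E)%E.
    move=> c0; rewrite ge0_integralZr//; first by rewrite -/(Imu g) iE.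
    by move=> x _; rewrite lee_fin.
  (* Wherever g(x) is nonzero, the inner integral of [haar_double_integral] is within e of [Jlam f];
     integrating against g, of total mass i, puts [Imu f * j] within e i of [Jlam f * i]. *)
  have est f : Cc f -> (forall x, 0 <= f x) ->
      (forall x, g x != 0 -> (Jlam (fun y => f (y * x)%g) <= Jlam f + e%:E)%E /\
        (Jlam f <= Jlam (fun y => f (y * x)%g) + e%:E)%E) ->
      `|fine (Imu f) * j - fine (Jlam f) * i| <= e * i.
    move=> Cf f0 fN.
    have key := haar_double_integral Cf Ccg f0 g0.
    have fE : Imu f = (fine (Imu f))%:E by rewrite fineK// Ifin.
    have FE : Jlam f = (fine (Jlam f))%:E by rewrite fineK// Jfin.
    rewrite FE in fN; rewrite fE jE -EFinM in key.
    set a := fine (Imu f) in key *; set b := fine (Jlam f) in fN *.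
    have J0 x : (0 <= Jlam (fun y => f (y * x)%g))%E.
      by apply: integral_ge0 => y _; rewrite lee_fin mulr_ge0.
    have b0 : 0 <= b.
      by rewrite fine_ge0// integral_ge0// => y _; rewrite lee_fin mulr_ge0.
    have upper : a * j <= i * (b + e).
      have be0 : 0 <= b + e by rewrite addr_ge0// ltW.
      rewrite -lee_fin key -gc//; apply: ge0_le_integralT => x.
        by rewrite mule_ge0// lee_fin.
      have [->|gx] := eqVneq (g x) 0; first by rewrite !mul0e.
      by rewrite lee_wpmul2l ?lee_fin// EFinD; have [] := fN x gx.
    (* b - e may be negative, whereas lower integrals are compared between nonnegative functions;
       hence the truncation at 0. *)
    have lower : i * (b - e) <= a * j.
      apply: (@le_trans _ _ (i * Num.max 0 (b - e))).
        by rewrite ler_pM2l// le_max lexx orbT.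
      have m0 : 0 <= Num.max 0 (b - e) by rewrite le_max lexx.
      rewrite -lee_fin key -gc//; apply: ge0_le_integralT => x.
        by rewrite mule_ge0// lee_fin.
      have [->|gx] := eqVneq (g x) 0; first by rewrite !mul0e.
      rewrite lee_wpmul2l ?lee_fin//; have [_ bJ] := fN x gx.
      by rewrite EFin_max ge_max J0/= EFinB leeBlDr.
    by rewrite ler_norml; apply/andP; split; lra.
  have {}e1 : `|fine (Imu f1) * j - fine (Jlam f1) * i| <= e * i.
    apply: est => // x; apply: contra_neqP => fx; apply: gN => -[/fx].
    by [].
  have {}e2 : `|fine (Imu f2) * j - fine (Jlam f2) * i| <= e * i.
    apply: est => // x; apply: contra_neqP => fx; apply: gN => -[_ /fx].
    by [].
  set a1 := fine (Imu f1) in e1 *; set a2 := fine (Imu f2) in e2 *.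
  set b1 := fine (Jlam f1) in e1 *; set b2 := fine (Jlam f2) in e2 *.
  have a10 : 0 <= a1 by rewrite fine_ge0// integral_ge0// => x _; rewrite lee_fin.
  have a20 : 0 <= a2 by rewrite fine_ge0// integral_ge0// => x _; rewrite lee_fin.
  rewrite -(ler_pM2r i0) -{1}(gtr0_norm i0) -normrM.
  (* This combination of the two estimates eliminates j, the only quantity not controlled by f1, f2
     and the mass i. *)
  have -> : (b1 * a2 - b2 * a1) * i =
      (a2 * j - b2 * i) * a1 - (a1 * j - b1 * i) * a2 by ring.
  apply: le_trans (ler_normB _ _) _; rewrite !normrM (ger0_norm a10) (ger0_norm a20).
  have -> : e * (a1 + a2) * i = e * i * a1 + e * i * a2 by ring.
  by apply: lerD; apply: ler_wpM2r.
have [g [Ccg g0 _ g1]] := Cc_bump (filterT : nbhs (1%g : G) setT).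
have gI := haar_integral_gt0 Ccg.1 g0 g1.
have fingI := Ifin Ccg g0.
have i0 : 0 < fine (Imu g) by rewrite fine_gt0// gI -ge0_fin_numE// ltW.
exists (fine (Jlam g) / fine (Imu g)).
  apply: divr_ge0 (ltW i0).
  by rewrite fine_ge0// integral_ge0// => x _; rewrite lee_fin mulr_ge0.
move=> f Cf f0; rewrite -/(Jlam f) -/(Imu f).
rewrite -(fineK (Jfin Cf f0)) -(fineK (Ifin Cf f0)) -EFinM.
congr _%:E; apply: (mulIf (lt0r_neq0 i0)).
by rewrite [LHS]cross// [RHS]mulrAC divfK ?lt0r_neq0.
Qed.

End haar.

(** * Null sets of Haar measures *)

Section haar_null_sets.
Context (R : realType) (G : topGroupType).
Hypotheses (hG : hausdorff_space G) (lcG : locally_compact [set: G]).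

(** Uniqueness with weight 1 gives nu = c mu on C_c, hence nu <= (c + 1) mu on Borel sets. The
    passage to sets asks for a positive density while only c >= 0 is known, so c + 1 replaces c. *)
Lemma haar_null_unique (mu nu : {measure set (borel G) -> \bar R})
    (B : set (borel G)) :
  left_haar mu -> left_haar nu -> measurable B -> mu B = 0%E -> nu B = 0%E.
Proof.
move=> haarmu haarnu mB B0; have [nureg _ _] := haarnu; have [mureg _ _] := haarmu.
have c1 : continuous (fun=> 1 : R) := @cst_continuous G R 1.
have inv1 x (f : G -> R) : Cc f -> (forall y, 0 <= f y) ->
    (\int[nu]_y (f (x * y)%g * 1)%:E = \int[nu]_y (f y * 1)%:E)%E.
  move=> _ f0; apply: (left_haar_integral hG haarnu x (g := fun y => (f y * 1)%:E)).
  by move=> y; rewrite mulr1 lee_fin.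
have [c c0 cP] := haar_unique hG lcG haarmu nureg.1 c1 (fun=> ler01) inv1.
have idc : continuous (@id G) by move=> x.
have c10 : 0 < c + 1 by rewrite ltr_wpDl.
have main : (\int[nu]_x (\1_B x)%:E <= \int[mu]_y ((\1_B y)%:E * (c + 1)%:E))%E.
  apply: (@transfer_Cc R G G nu mu id id hG hG idc idc (fun=> erefl) (fun=> erefl)
    nureg (fun=> c + 1) (@cst_continuous G R (c + 1)) (fun=> c10) lcG mureg _
    (EFin \o \1_B)) => [phi Cphi phi0|y]; last by rewrite /= lee_fin.
  have := cP phi Cphi phi0.
  under eq_integral do rewrite mulr1.
  move=> ->; under [leRHS]eq_integral do rewrite EFinM.
  rewrite ge0_integralZr//; last 3 first.
  - by apply/measurable_EFinP; apply: continuous_borel_realfun; case: Cphi.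
  - by move=> y _; rewrite lee_fin.
  - by rewrite lee_fin ltW.
  rewrite muleC lee_wpmul2l// ?lee_fin ?lerDl//.
  by apply: integral_ge0 => y _; rewrite lee_fin.
move: main; rewrite ge0_integralZr//; last 2 first.
- by apply/measurable_EFinP; exact: measurable_indic.
- by rewrite lee_fin ltW.
rewrite !integral_indic// !setIT B0 mul0e => nuB.
by apply/eqP; rewrite eq_le nuB measure_ge0.
Qed.

(** Outer approximation is available only inside open sets of finite measure, so M is treated
    piecewise in the W n, with error e / 2^(n+1) in the n-th piece. *)
Lemma null_open_cover (mu : {measure set (borel G) -> \bar R}) (M : set G)
    (W : (set G)^nat) (e : R) :
  regular_borel mu -> measurable (M : set (borel G)) -> mu M = 0%E ->
  (forall n, open (W n)) -> (forall n, mu (W n) < +oo)%E -> 0 < e ->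
  exists U : set G, [/\ open U, M `&` \bigcup_n W n `<=` U,
    U `<=` \bigcup_n W n & (mu U <= e%:E)%E].
Proof.
move=> mureg mM M0 oW Wfin e0.
have mMW n : measurable (M `&` W n : set (borel G)).
  by apply: measurableI => //; exact: open_borel.
have MW0 n : mu (M `&` W n) = 0%E.
  apply: (@subset_measure0 _ (borel G) R mu _ M) => //.
have en0 n : 0 < e / (2 ^ n.+1)%:R by rewrite divr_gt0// ltr0n expn_gt0.
have /choice[U UP] : forall n, exists U : set G, [/\ open U, M `&` W n `<=` U,
    U `<=` W n & (mu U <= (e / (2 ^ n.+1)%:R)%:E)%E].
  move=> n.
  have [U [oU MU UW Ue]] := open_outer_approx hG mureg (mMW n) (oW n)
    (@subIsetr _ _ _) (Wfin n) (en0 n).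
  exists U; split => //; have mU := open_borel oU.
  rewrite -(setDUK MU) measureU//.
  - by rewrite [X in (X + _ <= _)%E](MW0 n) add0e.
  - exact: measurableD.
  - by rewrite setDIK.
exists (\bigcup_n U n); split.
- by apply: bigcup_open => n _; have [] := UP n.
- move=> x [Mx [n _ Wx]]; exists n => //.
  by have [_ + _ _] := UP n; apply.
- by apply: subset_bigcup => n _; have [] := UP n.
have mUn n : measurable (U n : set (borel G)).
  by apply: open_borel; have [] := UP n.
apply: (@le_trans _ _ (\sum_(0 <= n <oo) mu (U n))%E).
  apply: measure_sigma_subadditive => //.
  exact: bigcup_measurable.
apply: (@le_trans _ _ (\sum_(0 <= n <oo) (e / (2 ^ n.+1)%:R)%:E)%E).
  by apply: lee_nneseries => n *; [exact: measure_ge0|have [] := UP n].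
exact: epsilon_trick0 (ltW e0).
Qed.

(* G is the disjoint union of the cosets of the subgroup generated by a compact
   neighborhood of 1; these are open and sigma-compact. *)
Lemma haar_null_Gdelta (mu : {measure set (borel G) -> \bar R}) (M : set G) :
  left_haar mu -> measurable (M : set (borel G)) -> mu M = 0%E ->
  exists U : (set G)^nat, [/\ forall n, open (U n), M `<=` \bigcap_n U n &
    mu (\bigcap_n U n) = 0%E].
Proof.
move=> [mureg _ _] mM M0.
have [C0 + [cC0 _]] := lcG (I : setT (1%g : G)); rewrite withinET => C01.
pose V := C0° `&` [set x | C0° x^-1%g].
have V1 : V 1%g by split; rewrite /= ?invg1; exact: C01.
have oV : open V.
  apply: openI; first exact: open_interior.
  apply: (open_comp (f := fun x : G => x^-1%g)); last exact: open_interior.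
  by move=> x _; exact: invg_continuous.
have VV x : V x -> V x^-1%g by move=> [Vx Vx']; split => //=; rewrite invgK.
(* P n is the n-th power of the symmetric, relatively compact V; their union L below is the open
   subgroup that V generates. *)
pose P := fix P n := if n is n.+1 then [set (x * v)%g | x in P n & v in V]
  else [set 1%g].
have P1 v : V v -> P 1%N v.
  by move=> Vv; exists 1%g => //; exists v => //; rewrite mul1g.
have PM m n x y : P n x -> P m y -> P (m + n)%N (x * y)%g.
  elim: m y => [|m IH] y Px; first by move=> ->; rewrite mulg1.
  move=> [y' Py' [v Vv <-]]; exists (x * y')%g; first exact: IH.
  by exists v => //; rewrite mulgA.
have PV n x : P n x -> P n x^-1%g.
  elim: n x => [|n IH] x; first by move=> ->; rewrite /= invg1.
  move=> [x' Px' [v Vv <-]]; rewrite invgM -addn1.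
  by apply: PM; [exact/P1/VV|exact: IH].
have oP n : open (P n.+1).
  rewrite (_ : P n.+1 = \bigcup_(x in P n) [set (x * v)%g | v in V]).
    by apply: bigcup_open => x _; exact: open_mulg_image.
  apply/seteqP; split => [_ [x Px [v Vv <-]]|_ [x Px [v Vv <-]]].
    by exists x => //; exists v.
  by exists x => //; exists v.
have PC n : exists2 Q : set G, compact Q & P n `<=` Q.
  elim: n => [|n [Q cQ PQ]]; first by exists [set 1%g] => //; exact: compact_set1.
  exists [set (x * v)%g | x in Q & v in C0]; first exact: compact_mulg.
  move=> _ [x Px [v [/interior_subset Cv _] <-]].
  by exists x; [exact: PQ|exists v].
pose L := \bigcup_n P n.+1.
have LP n x : P n x -> L x.
  by move=> Px; exists n => //; exists x => //; exists 1%g => //; rewrite mulg1.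
have L1 : L 1%g by exact: (LP 0).
have LM x y : L x -> L y -> L (x * y)%g.
  by move=> [n _ Px] [m _ Py]; exact: LP (PM _ _ _ _ Px Py).
have LV x : L x -> L x^-1%g by move=> [n _ Px]; exact: LP (PV _ _ Px).
(* The chosen element depends only on the set, hence only on the coset xL; so [r] is constant on
   cosets and U (r x, k) is one choice for each coset. *)
pose r (x : G) : G := xget 1%g [set y | L (x^-1 * y)%g].
have rL x : L (x^-1 * r x)%g.
  have ex : exists y, L (x^-1 * y)%g by exists x; rewrite mulVg.
  exact: (@xgetPex _ 1%g [set y | L (x^-1 * y)%g] ex).
have rE x y : L (x^-1 * y)%g -> r x = r y.
  move=> Lxy; rewrite /r; congr xget; apply/seteqP; split => z /= Lz.
    by have := LM _ _ (LV _ Lxy) Lz; rewrite invgM invgK mulgA mulgK.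
  by have := LM _ _ Lxy Lz; rewrite mulgA mulgK.
pose W x n := [set (x * y)%g | y in P n.+1].
have oW x n : open (W x n) by exact: open_mulg_image.
have Wfin x n : (mu (W x n) < +oo)%E.
  have [Q cQ PQ] := PC n.+1.
  have cxQ : compact [set (x * y)%g | y in Q].
    by apply: continuous_image_compact cQ; exact: continuous_mulgl.
  apply: le_lt_trans (mureg.1 _ cxQ); apply: le_measure.
  - by rewrite inE; exact: open_borel.
  - by rewrite inE; exact: compact_borel.
  - exact: image_subset.
have WL x y : (\bigcup_n W x n) y <-> L (x^-1 * y)%g.
  split=> [[n _ [z Pz <-]]|[n _ Pn]]; first by rewrite mulKg; exists n.
  by exists n => //; exists (x^-1 * y)%g => //; rewrite mulVKg.
have /choice[U UP] : forall xk : G * nat, exists U : set G, [/\ open U,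
    M `&` \bigcup_n W xk.1 n `<=` U, U `<=` \bigcup_n W xk.1 n &
    (mu U <= (xk.2.+1%:R^-1)%:E)%E].
  by move=> [x k]; apply: null_open_cover => //=; rewrite invr_gt0.
(* With uncountably many cosets N k need not have small measure. The intersection over k is
   nevertheless null, since each of its compact subsets is covered by finitely many cosets and its
   part in each coset is null. *)
pose N k := \bigcup_x U (r x, k).
have oN k : open (N k).
  by apply: bigcup_open => x _; have [] := UP (r x, k).
exists N; split => //.
  move=> x Mx k _; exists x => //; have [_ MU _ _] := UP (r x, k).
  apply: MU; split => //; apply/WL => /=.
  by have := LV _ (rL x); rewrite invgM invgK.
have mN : measurable (\bigcap_n N n : set (borel G)).
  by apply: bigcap_measurable => // n _; exact: open_borel.
rewrite (mureg.2 _ mN); apply/eqP; rewrite eq_le; apply/andP; split; last first.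
  apply: ereal_sup_ubound; exists set0; last by rewrite measure0.
  by split => //; exact: compact0.
apply: ge_ereal_sup => _ [C [cC CN] <-].
pose F (x : G) := \bigcup_n W x n.
have oF x : open (F x) by apply: bigcup_open => n _; exact: oW.
have [i _|x Cx|D _ CD] := @compact_fset_cover G C G setT F cC.
- exact: oF.
- by exists x => //; apply/WL; rewrite mulVg.
have NF x : mu.-negligible (\bigcap_k U (r x, k)).
  have mU k : measurable (U (r x, k) : set (borel G)).
    by apply: open_borel; have [] := UP (r x, k).
  have mUU : measurable (\bigcap_k U (r x, k) : set (borel G)).
    exact: bigcap_measurable.
  exists (\bigcap_k U (r x, k)); split => //.
  apply/eqP; rewrite eq_le measure_ge0 andbT; apply/lee_addgt0Pr => e e0.
  rewrite add0e; have [k ke] : exists k, k.+1%:R^-1 < e.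
    by have := ltr_add_invr e0 => -[k]; rewrite add0r; exists k.
  apply: (@le_trans _ _ (mu (U (r x, k)))).
    by apply: le_measure; rewrite ?inE// => z; exact.
  by have [_ _ _ Ue] := UP (r x, k); apply: le_trans Ue _; rewrite lee_fin ltW.
have : mu.-negligible (\bigcup_(x in [set` D]) \bigcap_k U (r x, k)).
  rewrite -bigsetU_fset_set// set_fsetK.
  elim/big_ind : _ => //; first exact: negligible_set0.
  exact: (@negligibleU _ (borel G) R mu).
(* A point of N k comes from some U (r y, k); this set lies in the coset of y, so the point's own
   coset is that of y. *)
suff CU : C `<=` \bigcup_(x in [set` D]) \bigcap_k U (r x, k).
  move/(@negligibleS _ (borel G) R mu _ _ CU).
  by move/(measure_negligible (compact_borel hG cC)) => /= ->.
move=> z Cz; have [x xD /WL Lxz] := CD z Cz; exists x => // k _.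
have [y _ Uyz] := CN z Cz k I; have [_ _ UW _] := UP (r y, k).
have /WL/= Lyz := UW z Uyz.
have yz : L (y^-1 * z)%g by have := LM _ _ (rL y) Lyz; rewrite mulgA mulgK.
by rewrite (rE _ _ Lxz) -(rE _ _ yz).
Qed.

End haar_null_sets.

(** * The decomposition G = KH *)

Lemma injective_hausdorff (X Y : topologicalType) (f : X -> Y) :
  continuous f -> injective f -> hausdorff_space Y -> hausdorff_space X.
Proof.
move=> cf fI hY x y clxy; apply: fI; apply: hY => A B Ax By.
have [z [Az Bz]] := clxy _ _ (cf _ _ Ax) (cf _ _ By).
by exists (f z).
Qed.

Lemma borel_pushforward (R : realType) (X Y : ptopologicalType) (f : X -> Y)
    (mu : {measure set (borel X) -> \bar R}) : continuous f ->
  exists nu : {measure set (borel Y) -> \bar R}, forall A, nu A = mu (f @^-1` A).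
Proof.
move=> /continuous_borel mf.
by exists (measure_function_pushforward__canonical__measure_function_Measure mu mf).
Qed.

Section homeomorphism_pushforward.
Context (R : realType) (X Y : ptopologicalType) (T : X -> Y) (T' : Y -> X).
Variables (mu : {measure set (borel X) -> \bar R}).
Variables (nu : {measure set (borel Y) -> \bar R}).
Hypotheses (hX : hausdorff_space X) (hY : hausdorff_space Y).
Hypotheses (cT : continuous T) (cT' : continuous T').
Hypotheses (TK : cancel T T') (T'K : cancel T' T).
Hypotheses (mu_reg : regular_borel mu) (nuE : forall A, nu A = mu (T @^-1` A)).

Let preimageE (A : set Y) : T @^-1` A = T' @` A.
Proof.
apply/seteqP; split => [x Ax|_ [y Ay <-]]; first by exists (T x).
by rewrite /preimage /= T'K.
Qed.

Lemma homeomorphism_regular_borel : regular_borel nu.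
Proof.
split=> [C cC|A mA].
  by rewrite nuE preimageE; apply: mu_reg.1; exact: continuous_image_compact.
rewrite nuE mu_reg.2; last exact: (preimage_borel cT).
congr ereal_sup; apply/seteqP; split => [_ [C [cC CA] <-]|_ [C [cC CA] <-]].
  exists (T @` C); first split; [exact: continuous_image_compact|..].
    by move=> _ [x /CA Ax <-].
  rewrite nuE; congr (mu _); apply/seteqP; split => [x [y Cy]|x Cx]; last by exists x.
  by move/(can_inj TK) <-.
exists (T @^-1` C) => //; split; last by move=> x /CA.
by rewrite preimageE; exact: continuous_image_compact.
Qed.

(** Both inequalities are instances of [transfer_compact] with density 1, for T and for T'; no
    measurability of g is involved. *)
Lemma homeomorphism_integral (g : Y -> \bar R) : (forall y, 0 <= g y)%E ->
  (\int[nu]_y g y = \int[mu]_x g (T x))%E.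
Proof.
move=> g0; apply/eqP; rewrite eq_le; apply/andP; split.
  have := @transfer_compact R Y X nu mu T' T hY cT T'K TK
    homeomorphism_regular_borel (fun=> 1) (@cst_continuous X R 1) (fun=> ltr01).
  move/(_ _ (g \o T)) => /= H.
  have {}H := H _ (fun x => g0 (T x)).
  rewrite (_ : \int[nu]_y g y = \int[nu]_y g (T (T' y)))%E; last first.
    by apply: eq_integral => y _; rewrite T'K.
  apply: le_trans (H _) _ => [C cC|]; last by under eq_integral do rewrite mule1.
  rewrite integral_cst ?mul1e/=; last first.
    by apply: compact_borel => //; exact: continuous_image_compact.
  by rewrite nuE preimageE.
have := @transfer_compact R X Y mu nu T T' hX cT' TK T'K
  mu_reg (fun=> 1) (@cst_continuous Y R 1) (fun=> ltr01).
move/(_ _ g g0) => H.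
apply: le_trans (H _) _ => [C cC|]; last by under eq_integral do rewrite mule1.
rewrite integral_cst ?mul1e/=; last first.
  by apply: compact_borel => //; exact: continuous_image_compact.
rewrite nuE (_ : T @^-1` _ = C)//.
apply/seteqP; split => [x [y Cy]|x Cx]; last by exists x.
by move/(can_inj TK) <-.
Qed.

End homeomorphism_pushforward.

Section decomposition.
Context (G : topGroupType) (H K : closed_subgroup G).
Hypothesis lcG : locally_compact_group G.
Hypothesis KHG : homeomorphism
  (fun kh : K * H => (csg_val kh.1 * csg_val kh.2)%g).
Variables (kpart : G -> K) (hpart : G -> H).
Hypothesis kh_part :
  forall x : G, x = (csg_val (kpart x) * csg_val (hpart x))%g.
Implicit Types (x y : G) (k : K) (h : H).

Lemma kh_partE k h : kpart (csg_val k * csg_val h)%g = k /\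
  hpart (csg_val k * csg_val h)%g = h.
Proof.
have [_ [g [_ gK _]]] := KHG; set x := (csg_val k * csg_val h)%g.
have := congr1 g (kh_part x).
by rewrite (gK (k, h)) (gK (kpart x, hpart x)) => -[<- <-].
Qed.

Lemma continuous_kpart : continuous kpart.
Proof.
have [_ [g [cg gK _]]] := KHG.
have -> : kpart = fst \o g.
  by apply/funext => x; rewrite /= {2}(kh_part x) (gK (kpart x, hpart x)).
by move=> x; apply: continuous_comp; [exact: cg|exact: cvg_fst].
Qed.

Lemma continuous_hpart : continuous hpart.
Proof.
have [_ [g [cg gK _]]] := KHG.
have -> : hpart = snd \o g.
  by apply/funext => x; rewrite /= {2}(kh_part x) (gK (kpart x, hpart x)).
by move=> x; apply: continuous_comp; [exact: cg|exact: cvg_snd].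
Qed.

Lemma kpart_val k : kpart (csg_val k) = k.
Proof. by have [] := kh_partE k 1%g; rewrite mulg1. Qed.

Lemma hpart_val k : hpart (csg_val k) = 1%g.
Proof. by have [] := kh_partE k 1%g; rewrite mulg1. Qed.

Lemma hpart_valH h : hpart (csg_val h) = h.
Proof. by have [] := kh_partE 1%g h; rewrite mul1g. Qed.

Lemma kh_partMr x h : kpart (x * csg_val h)%g = kpart x /\
  hpart (x * csg_val h)%g = (hpart x * h)%g.
Proof.
rewrite {1 3}(kh_part x) -mulgA.
exact: (kh_partE (kpart x) (hpart x * h)%g).
Qed.

Lemma kh_partMl k x : kpart (csg_val k * x)%g = (k * kpart x)%g /\
  hpart (csg_val k * x)%g = hpart x.
Proof.
rewrite {1 3}(kh_part x) mulgA.
exact: (kh_partE (k * kpart x)%g (hpart x)).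
Qed.

(** The factor h_y stays on the right and does not influence the K-part of xy. Hence x . k is an
    action of G on K, and x, k |-> h_(xk) is a cocycle for it. *)
Lemma kh_partM x y : kpart (x * y)%g = kpart (x * csg_val (kpart y))%g /\
  hpart (x * y)%g = (hpart (x * csg_val (kpart y)) * hpart y)%g.
Proof. by rewrite {1 3}(kh_part y) mulgA; exact: kh_partMr. Qed.

Lemma csg_hausdorff (S : closed_subgroup G) : hausdorff_space S.
Proof.
apply: (injective_hausdorff (@csg_val_continuous _ S) (@csg_val_inj _ S)).
by case: lcG.
Qed.

(** If U is a compact neighborhood of s in G, then r(U) is compact and contains the trace of U on S,
    because r fixes S. *)
Lemma retract_locally_compact (S : closed_subgroup G) (r : G -> S) :
  continuous r -> (forall s, r (csg_val s) = s) -> locally_compact [set: S].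
Proof.
move=> cr rK s _; rewrite withinET.
have [U + [cU clU]] := lcG.2 (csg_val s) I; rewrite withinET => Us.
have cC : compact (r @` U) by exact: continuous_image_compact.
exists (r @` U); last by split => //; apply: compact_closed cC; exact: csg_hausdorff.
have : nbhs s (csg_val (S := S) @^-1` U) by exact: (csg_val_continuous Us).
by apply: filterS => t /= Ut; exists (csg_val t).
Qed.

Lemma K_locally_compact : locally_compact [set: K].
Proof. exact: retract_locally_compact continuous_kpart kpart_val. Qed.

Lemma H_locally_compact : locally_compact [set: H].
Proof. exact: retract_locally_compact continuous_hpart hpart_valH. Qed.

Lemma continuous_Kaction x : continuous (fun k => kpart (x * csg_val k)%g).
Proof.
move=> k; apply: (@continuous_comp _ _ _ (fun k => x * csg_val k)%g kpart).
  by apply: continuous_comp; [exact: csg_val_continuous|exact: continuous_mulgl].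
exact: continuous_kpart.
Qed.

Lemma KactionK x : cancel (fun k => kpart (x * csg_val k)%g)
  (fun k => kpart (x^-1 * csg_val k)%g).
Proof. by move=> k; rewrite -(kh_partM _ _).1 mulKg kpart_val. Qed.

Lemma KactionVK x : cancel (fun k => kpart (x^-1 * csg_val k)%g)
  (fun k => kpart (x * csg_val k)%g).
Proof. by move=> k; rewrite -(kh_partM _ _).1 mulVKg kpart_val. Qed.

Section cross_section.
Variable p : coset_space H -> G.
Hypothesis hp : cross_section p.

Lemma to_coset_kpart x y : to_coset H x = to_coset H y -> kpart x = kpart y.
Proof.
move/eqmodP/asboolP => Hxy.
pose h : H := exist _ (x^-1 * y)%g (mem_set Hxy).
have -> : y = (x * csg_val h)%g by rewrite /csg_val /= mulVKg.
by rewrite (kh_partMr _ _).1.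
Qed.

Lemma to_coset_mulr x h : to_coset H (x * csg_val h)%g = to_coset H x.
Proof.
apply/eqmodP/asboolP; rewrite invgM -mulgA mulVg mulg1.
by apply: csgV; exact: set_mem (valP h).
Qed.

(** Composed with the quotient map this is [kpart] itself, whatever the cross-section: the K-part is
    constant on cosets of H. *)
Lemma continuous_kpart_section : continuous (fun w => kpart (p w)).
Proof.
apply/(quotient_continuous (Q0 := {eq_quot (lcoset_equiv H)}%qT)).
rewrite (_ : _ \o _ = kpart); first exact: continuous_kpart.
by apply/funext => x /=; apply: to_coset_kpart; exact: hp.
Qed.

Lemma continuous_to_coset : continuous (fun k => to_coset H (csg_val k)).
Proof.
move=> k; apply: continuous_comp; first exact: csg_val_continuous.
exact: pi_continuous.
Qed.

Lemma kpart_sectionK :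
  cancel (fun w => kpart (p w)) (fun k => to_coset H (csg_val k)).
Proof.
move=> w; rewrite -[RHS]hp {2}(kh_part (p w)); exact/esym/to_coset_mulr.
Qed.

Lemma to_cosetK : cancel (fun k => to_coset H (csg_val k)) (fun w => kpart (p w)).
Proof. by move=> k; rewrite (to_coset_kpart (hp _)) kpart_val. Qed.

Lemma coset_hausdorff : hausdorff_space (coset_space H).
Proof.
apply: (injective_hausdorff continuous_kpart_section).
  exact: (can_inj kpart_sectionK).
exact: csg_hausdorff.
Qed.

End cross_section.

(** * Null sets of K and null unions of H-cosets in G *)

Section negligible.
Variable R : realType.
Variables (muG : {measure set (borel G) -> \bar R}).
Variables (muK : {measure set (borel K) -> \bar R}).
Hypotheses (haarG : left_haar muG) (haarK : left_haar muK).

(** Left translation by K leaves the H-part unchanged, whence invariance. For inner regularity, a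
    compact subset C of BW lies in kpart(C) W, so kpart(C) is a compact subset of B of at least the
    measure of C. Finiteness on compact sets comes from Q, and nonvanishing from the open set KW. *)
Lemma fiber_left_haar (W Q : set H) : open W -> W !=set0 -> compact Q ->
  W `<=` Q -> exists2 nu : {measure set (borel K) -> \bar R}, left_haar nu &
  forall B, nu B = muG (kpart @^-1` B `&` hpart @^-1` W).
Proof.
move=> oW [h0 Wh0] cQ WQ; have [Greg GT Ginv] := haarG.
have oHW : open (hpart @^-1` W).
  by apply: open_comp => // x _; exact: continuous_hpart.
have mW := open_borel oHW.
have [nu nuE'] := borel_pushforward (mrestr muG mW) continuous_kpart.
have nuE B : nu B = muG (kpart @^-1` B `&` hpart @^-1` W) by rewrite nuE'.
exists nu => //.
have mkW B : measurable (B : set (borel K)) ->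
    measurable (kpart @^-1` B `&` hpart @^-1` W : set (borel G)).
  by move=> mB; apply: measurableI => //; exact: (preimage_borel continuous_kpart).
have hK := @csg_hausdorff K.
split; first split.
- move=> C cC; rewrite nuE.
  have cCQ := compact_mulg (continuous_image_compact (@csg_val_continuous _ K) cC)
    (continuous_image_compact (@csg_val_continuous _ H) cQ).
  apply: le_lt_trans (Greg.1 _ cCQ); apply: le_measure.
  + by rewrite inE; apply: mkW; exact: compact_borel.
  + by rewrite inE; apply: compact_borel => //; case: lcG.
  + move=> x [/= Cx Wx]; exists (csg_val (kpart x)); first by exists (kpart x).
    exists (csg_val (hpart x)); first by exists (hpart x) => //; exact: WQ.
    by rewrite -kh_part.
- move=> B mB; apply/eqP; rewrite eq_le; apply/andP; split; last first.
    apply: ge_ereal_sup => _ [C [cC CB] <-]; apply: le_measure => //.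
    + by rewrite inE; exact: compact_borel.
    + by rewrite inE.
  rewrite nuE (Greg.2 _ (mkW _ mB)); apply: ge_ereal_sup => _ [C [cC CB] <-].
  have cD : compact (kpart @` C).
    by apply: continuous_image_compact cC; exact: continuous_kpart.
  apply: (@le_trans _ _ (nu (kpart @` C))).
    rewrite nuE; apply: le_measure.
    + by rewrite inE; apply: compact_borel => //; case: lcG.
    + by rewrite inE; apply: mkW; exact: compact_borel.
    + by move=> x Cx; split; [exists x|have [] := CB x Cx].
  apply: ereal_sup_ubound; exists (kpart @` C) => //; split => //.
  by move=> _ [x /CB[? _] <-].
- rewrite nuE preimage_setT setTI.
  rewrite gt_eqF//; apply: open_haar_gt0 => //; first by case: lcG.
  by exists (csg_val h0); rewrite /= hpart_valH.
- move=> k B mB; rewrite !nuE -[RHS](Ginv (csg_val k)); last exact: mkW.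
  congr (muG _); apply/seteqP; split.
    move=> x [/= [k' Bk' kk'] Wx].
    exists ((csg_val k)^-1 * x)%g; last by rewrite mulVKg.
    have [kE hE] := kh_partMl (k^-1)%g x.
    by split; rewrite /= ?kE ?hE// -kk' mulKg.
  move=> _ [x [/= Bx Wx] <-]; have [kE hE] := kh_partMl k x.
  by split; rewrite /= ?kE ?hE//; exists (kpart x).
Qed.

(** By inner regularity only compact subsets C of BH matter. The H-part of C stays in some
    relatively compact open W, so C lies in BW, which is null because B |-> muG(BW) is a Haar
    measure of K. *)
Lemma negligible_kpart (S : set K) :
  muK.-negligible S -> muG.-negligible (kpart @^-1` S).
Proof.
move=> [B [mB B0 SB]]; have [Greg _ _] := haarG.
have mkB : measurable (kpart @^-1` B : set (borel G)).
  exact: (preimage_borel continuous_kpart).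
exists (kpart @^-1` B); split => //; last by move=> x /SB.
apply/eqP; rewrite eq_le measure_ge0 andbT (Greg.2 _ mkB).
apply: ge_ereal_sup => _ [C [cC CB] <-].
(* The point 1 makes the interior of Q nonempty even when C is empty. *)
have cD : compact (hpart @` C `|` [set 1%g]).
  apply: compactU; last exact: compact_set1.
  by apply: continuous_image_compact cC; exact: continuous_hpart.
have [Q cQ DQ] := compact_interior_cover H_locally_compact cD.
have [|nu haarnu nuE] :=
  fiber_left_haar (@open_interior _ Q) _ cQ (@interior_subset _ Q).
  by exists 1%g; apply: DQ; right.
have nuB := haar_null_unique (@csg_hausdorff K) K_locally_compact haarK haarnu mB B0.
rewrite -nuB nuE; apply: le_measure.
- by rewrite inE; apply: compact_borel => //; case: lcG.
- rewrite inE; apply: measurableI => //; apply: open_borel; apply: open_comp.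
    by move=> x _; exact: continuous_hpart.
  exact: open_interior.
- by move=> x Cx; split; [exact: CB|apply: DQ; left; exists x].
Qed.

(* If SH lies in a null G_delta set, then S lies in the set of those k for which
   kQ does, which is a G_delta set as well because Q is compact. *)
Lemma kpart_negligible (S : set K) :
  muG.-negligible (kpart @^-1` S) -> muK.-negligible S.
Proof.
move=> [M [mM M0 SM]]; have [hG lcGG] := lcG.
have [U [oU MU U0]] := haar_null_Gdelta hG lcGG haarG mM M0.
have [Q cQ Q1] := compact_interior_cover H_locally_compact (@compact_set1 _ (1%g : H)).
have [|nu haarnu nuE] :=
  fiber_left_haar (@open_interior _ Q) _ cQ (@interior_subset _ Q).
  by exists 1%g; exact: Q1.
pose N n := [set k : K | Q `<=` (fun h => U n (csg_val k * csg_val h)%g)].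
have oN n : open (N n).
  rewrite openE => k Nk.
  suff : \forall k' \near k, Q `<=` (fun h => U n (csg_val k' * csg_val h)%g) by [].
  (* Tube lemma: each (k, h) with h in Q has a box that multiplication sends into U n, and
     compactness of Q yields one neighborhood of k for all h. *)
  have /compact_near_coveringP cov := cQ.
  apply: (cov K (nbhs k) (fun k' h => U n (csg_val k' * csg_val h)%g)) => h Qh.
  have : open_nbhs (k, h)
      ((fun kh : K * H => (csg_val kh.1 * csg_val kh.2)%g) @^-1` (U n)).
    split; last exact: Nk.
    by apply: open_comp => // x _; have [cm _] := KHG; exact: cm.
  move=> /open_nbhs_nbhs[[A B] /= [Ak Bh] AB].
  exists (B, A) => //= -[h' k'] /= [Bh' Ak'].
  exact: (AB (k', h')).
have mN : measurable (\bigcap_n N n : set (borel K)).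
  by apply: bigcap_measurable => // n _; exact: open_borel.
exists (\bigcap_n N n); split => //; last first.
  move=> k Sk n _ h _; apply: MU => //; apply: SM.
  by rewrite /= (kh_partE k h).1.
(* The product of this intersection with the interior of Q lies in the null set \bigcap_n U n, so
   the intersection is null for the Haar measure [nu], hence for [muK]. *)
apply: (haar_null_unique (@csg_hausdorff K) K_locally_compact haarnu haarK mN).
apply/eqP; rewrite nuE eq_le measure_ge0 andbT -U0; apply: le_measure.
- rewrite inE; apply: measurableI.
    exact: (preimage_borel continuous_kpart).
  apply: open_borel; apply: open_comp.
    by move=> x _; exact: continuous_hpart.
  exact: open_interior.
- by rewrite inE; apply: bigcap_measurable => // n _; exact: open_borel.
- move=> x [/= Nx Qx] n _; rewrite (kh_part x); apply: (Nx n I).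
  exact: interior_subset.
Qed.

End negligible.

End decomposition.

(** * Quasi-invariance of the measure on K *)

Section quasi_invariance.
Context (R : realType) (G : topGroupType) (H K : closed_subgroup G).
Hypothesis lcG : locally_compact_group G.
Hypothesis KHG : homeomorphism
  (fun kh : K * H => (csg_val kh.1 * csg_val kh.2)%g).
Variables (kpart : G -> K) (hpart : G -> H).
Hypothesis kh_part :
  forall x : G, x = (csg_val (kpart x) * csg_val (hpart x))%g.
Variables (muG : {measure set (borel G) -> \bar R}).
Variables (muH : {measure set (borel H) -> \bar R}).
Variables (muK : {measure set (borel K) -> \bar R}).
Hypotheses (haarG : left_haar muG) (haarH : left_haar muH).
Hypothesis haarK : left_haar muK.
Variables (DeltaG : G -> R) (DeltaH : H -> R) (rho : G -> R).
Hypothesis hrho : rho_function DeltaG DeltaH rho.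
Variable p : coset_space H -> G.
Hypothesis hp : cross_section p.
Variable mu_rho : {measure set (borel (coset_space H)) -> \bar R}.
Hypothesis hmu_rho : rho_measure muG muH rho p mu_rho.
Implicit Types (x y : G) (k : K) (h : H).

Let hG : hausdorff_space G. Proof. by case: lcG. Qed.
Let hK : hausdorff_space K. Proof. exact: csg_hausdorff. Qed.
Let hH : hausdorff_space H. Proof. exact: csg_hausdorff. Qed.
Let lcK : locally_compact [set: K].
Proof. exact: (K_locally_compact lcG KHG kh_part). Qed.
Let lcH : locally_compact [set: H].
Proof. exact: (H_locally_compact lcG KHG kh_part). Qed.
Let ckpart : continuous kpart. Proof. exact: (continuous_kpart KHG kh_part). Qed.
Let chpart : continuous hpart. Proof. exact: (continuous_hpart KHG kh_part). Qed.
Let cvalK := @csg_val_continuous G K.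
Let cact x : continuous (fun k => kpart (x * csg_val k)%g).
Proof. exact: (continuous_Kaction KHG kh_part). Qed.
Let crho : continuous rho. Proof. by case: hrho. Qed.
Let rho0 x : 0 < rho x. Proof. by case: hrho => _ + _. Qed.
(** Numerator and denominator acquire the same factor at h_y, which is nonzero because rho is
    positive. *)
Let rho_ratio x y : rho (x * y)%g / rho y =
  rho (x * csg_val (kpart y))%g / rho (csg_val (kpart y)).
Proof.
have [_ _ rhoM] := hrho; rewrite {1 2}(kh_part y) mulgA !rhoM.
set a := DeltaH _ / _; rewrite -mulf_div divff ?mul1r//.
apply: contraTneq (rho0 (csg_val (kpart y) * csg_val (hpart y))%g) => a0.
by rewrite rhoM -/a a0 mul0r ltxx.
Qed.
Let cont_comp (S T U : topologicalType) (f : S -> T) (g : T -> U) :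
  continuous f -> continuous g -> continuous (fun s => g (f s)).
Proof. by move=> cf cg s; apply: continuous_comp; [exact: cf|exact: cg]. Qed.
Let crhoK x : continuous (fun k => rho (x * csg_val k)%g).
Proof.
apply: (cont_comp _ crho); apply: (cont_comp cvalK).
exact: continuous_mulgl.
Qed.
Let crhoK1 : continuous (fun k => rho (csg_val k)).
Proof. exact: (cont_comp cvalK crho). Qed.

Lemma Cc_tensor (phi : K -> R) (psi : H -> R) : Cc phi -> Cc psi ->
  Cc (fun x => phi (kpart x) * psi (hpart x)).
Proof.
move=> [cphi cS] [cpsi cS'].
have cD := compact_mulg (continuous_image_compact cvalK cS)
  (continuous_image_compact (@csg_val_continuous G H) cS').
apply: (Cc_compact_support hG _ cD) => [x|x Dx].
  by apply: cvgM; [exact: (cont_comp ckpart cphi)|exact: (cont_comp chpart cpsi)].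
have [Sx|Sx] := pselect (closure [set k | phi k != 0] (kpart x)); last first.
  by rewrite (CcP0 Sx) mul0r.
rewrite (CcP0 (f := psi)) ?mulr0// => Sx'; apply: Dx.
exists (csg_val (kpart x)); first by exists (kpart x).
by exists (csg_val (hpart x)); [exists (hpart x)|rewrite -kh_part].
Qed.

Section image_measure.
Variable lam : {measure set (borel K) -> \bar R}.
Hypothesis lamE : forall A, lam A = mu_rho ((fun w => kpart (p w)) @^-1` A).

Let lam_int (g : K -> \bar R) : (forall k, 0 <= g k)%E ->
  (\int[lam]_k g k = \int[mu_rho]_w g (kpart (p w)))%E.
Proof.
apply: (homeomorphism_integral (coset_hausdorff lcG KHG kh_part hp) hK
  (continuous_kpart_section KHG kh_part hp) (@continuous_to_coset _ H K)
  (kpart_sectionK kh_part hp) (to_cosetK KHG kh_part hp) hmu_rho.1 lamE).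
Qed.

Lemma image_regular_borel : regular_borel lam.
Proof.
exact: (homeomorphism_regular_borel
  (continuous_kpart_section KHG kh_part hp) (@continuous_to_coset _ H K)
  (kpart_sectionK kh_part hp) (to_cosetK KHG kh_part hp) hmu_rho.1 lamE).
Qed.

Let mK (f : K -> R) : continuous f ->
  measurable_fun setT (fun k : borel K => (f k)%:E).
Proof. by move=> cf; apply/measurable_EFinP; exact: continuous_borel_realfun. Qed.

(** Along the coset of p(w) the factor phi is constant and the H-part of x p(w) h is that of x p(w)
    times h. Left invariance of [muH] absorbs this factor and leaves the integral of psi. *)
Lemma rho_measure_tensor (phi : K -> R) (psi : H -> R) x : Cc phi -> Cc psi ->
  (forall k, 0 <= phi k) -> (forall h, 0 <= psi h) ->
  \int[muG]_y (phi (kpart (x * y)%g) * psi (hpart (x * y)%g) * rho y) =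
  fine (\int[lam]_k (phi (kpart (x * csg_val k)%g))%:E)%E *
  fine (\int[muH]_h (psi h)%:E)%E.
Proof.
move=> Cphi Cpsi phi0 psi0; have [_ hmu] := hmu_rho.
have Cf : Cc (fun y => phi (kpart (x * y)%g) * psi (hpart (x * y)%g)).
  apply: (Cc_comp (f := fun y => phi (kpart y) * psi (hpart y))
    (T' := fun y => (x^-1 * y)%g) hG
    (@continuous_mulgl _ x) (@continuous_mulgl _ _) (@mulKg _ x)).
  exact: Cc_tensor.
rewrite (hmu _ Cf) /Rintegral.
have psifin : (\int[muH]_h (psi h)%:E)%E \is a fin_num.
  rewrite ge0_fin_numE; last by apply: integral_ge0 => h _; rewrite lee_fin.
  by apply: Cc_integral_lty => // C; case: haarH => -[+ _] _ _; exact.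
set s := fine (\int[muH]_h (psi h)%:E)%E.
have s0 : 0 <= s by rewrite fine_ge0// integral_ge0// => h _; rewrite lee_fin.
have inner w : fine (\int[muH]_h (phi (kpart (x * (p w * csg_val h))%g) *
      psi (hpart (x * (p w * csg_val h))%g))%:E)%E =
    phi (kpart (x * csg_val (kpart (p w)))%g) * s.
  rewrite -(kh_partM KHG kh_part _ _).1; set y := (x * p w)%g.
  under eq_integral do rewrite mulgA (kh_partMr KHG kh_part _ _).1
    (kh_partMr KHG kh_part _ _).2 EFinM.
  rewrite ge0_integralZl//; last 3 first.
  - apply/measurable_EFinP; apply: continuous_borel_realfun.
    exact: (cont_comp (@continuous_mulgl _ (hpart y)) Cpsi.1).
  - by move=> h _; rewrite lee_fin.
  - by rewrite lee_fin.
  rewrite (left_haar_integral hH haarH (hpart y)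
    (g := fun h => (psi h)%:E)); last first.
    by move=> h; rewrite lee_fin.
  by rewrite fineM.
under eq_integral do rewrite inner.
rewrite -(lam_int (g := fun k => (phi (kpart (x * csg_val k)%g) * s)%:E)); last first.
  by move=> k; rewrite lee_fin mulr_ge0.
under eq_integral do rewrite EFinM.
have Cphix : Cc (fun k => phi (kpart (x * csg_val k)%g)).
  apply: (Cc_comp hK (@cact x) (@cact x^-1%g)) => //.
  exact: (KactionK KHG kh_part).
rewrite ge0_integralZr//; last 2 first.
- exact: (mK Cphix.1).
- by move=> k _; rewrite lee_fin.
rewrite fineM// ge0_fin_numE; last first.
  by apply: integral_ge0 => k _; rewrite lee_fin.
by apply: Cc_integral_lty => // C; case: image_regular_borel => + _; exact.
Qed.

(** The substitution of xy for y in the G-integral replaces rho(y) by rho(xy), and [rho_ratio] moves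
    the quotient rho(xy) / rho(y) onto the K-variable. The auxiliary psi has a positive integral and
    is divided out. *)
Lemma image_quasi_invariant (phi : K -> R) x : Cc phi ->
  (forall k, 0 <= phi k) ->
  (\int[lam]_k (phi (kpart (x^-1 * csg_val k)%g))%:E =
   \int[lam]_k (phi k * (rho (x * csg_val k)%g / rho (csg_val k)))%:E)%E.
Proof.
move=> Cphi phi0.
have [psi [Cpsi psi0 _ psi1]] := Cc_bump R hH lcH (filterT : nbhs (1%g : H) setT).
have psiI := haar_integral_gt0 hH haarH Cpsi.1 psi0 psi1.
have s0 : 0 < fine (\int[muH]_h (psi h)%:E)%E.
  rewrite fine_gt0// psiI/=; apply: Cc_integral_lty => // C.
  by case: haarH => -[+ _] _ _; exact.
pose phi2 k := phi k * (rho (x * csg_val k)%g / rho (csg_val k)).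
have cratio : continuous (fun k => rho (x * csg_val k)%g / rho (csg_val k)).
  apply: (continuous_mulfun (@crhoK x)); apply: continuous_invfun crhoK1 => k.
  by rewrite gt_eqF.
have Cphi2 : Cc phi2 by exact: Cc_mul.
have phi20 k : 0 <= phi2 k by rewrite mulr_ge0// divr_ge0// ltW.
have E1 := rho_measure_tensor x^-1%g Cphi Cpsi phi0 psi0.
have E2 := rho_measure_tensor 1%g Cphi2 Cpsi phi20 psi0.
have Cphix : Cc (fun k => phi (kpart (x^-1 * csg_val k)%g)).
  apply: (Cc_comp hK (@cact x^-1%g) (@cact x)) => //.
  exact: (KactionVK KHG kh_part).
have fin (f : K -> R) : Cc f -> (forall k, 0 <= f k) ->
    (\int[lam]_k (f k)%:E)%E \is a fin_num.
  move=> Cf f0; rewrite ge0_fin_numE; last first.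
    by apply: integral_ge0 => k _; rewrite lee_fin.
  by apply: Cc_integral_lty => // C; case: image_regular_borel => + _; exact.
rewrite -(fineK (fin _ Cphix _))// -(fineK (fin _ Cphi2 _))//.
congr _%:E; apply: (mulIf (lt0r_neq0 s0)); rewrite -E1.
rewrite [X in _ = fine X * _](_ : _ =
    \int[lam]_k (phi2 (kpart (1%g * csg_val k)%g))%:E)%E; last first.
  by apply: eq_integral => k _; rewrite mul1g (kpart_val KHG kh_part).
rewrite -E2 /Rintegral; congr fine.
rewrite -(left_haar_integral hG haarG x); last first.
  by move=> y; rewrite lee_fin !mulr_ge0// ltW.
apply: eq_integral => y _; rewrite mulKg mul1g /phi2 -rho_ratio; congr _%:E.
by field; rewrite gt_eqF.
Qed.

Let crhoV : continuous (fun k => (rho (csg_val k))^-1).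
Proof. by apply: continuous_invfun crhoK1 => k; rewrite gt_eqF. Qed.

Lemma image_measure_haar : exists2 c : R, 0 < c & forall phi : K -> R, Cc phi ->
  (forall k, 0 <= phi k) ->
  (\int[lam]_k (phi k)%:E = \int[muK]_k (phi k * (c * rho (csg_val k)))%:E)%E.
Proof.
have lamfin (C : set K) : compact C -> (lam C < +oo)%E.
  by case: image_regular_borel => + _; exact.
have rhoV0 k : 0 <= (rho (csg_val k))^-1 by rewrite invr_ge0 ltW.
have lam_inv k0 (f : K -> R) : Cc f -> (forall k, 0 <= f k) ->
    (\int[lam]_k (f (k0 * k)%g * (rho (csg_val k))^-1)%:E =
     \int[lam]_k (f k * (rho (csg_val k))^-1)%:E)%E.
  move=> Cf f0; pose x := ((csg_val k0)^-1)%g.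
  (* This divisor cancels the numerator of the quasi-invariance density; on the left it becomes
     rho(k), since x k0 = 1. *)
  pose f' k := f k * (rho (x * csg_val k)%g)^-1.
  have Cf' : Cc f'.
    apply: Cc_mul => //; apply: continuous_invfun (@crhoK x) => k.
    by rewrite gt_eqF.
  have f'0 k : 0 <= f' k by rewrite mulr_ge0// invr_ge0 ltW.
  have := image_quasi_invariant x Cf' f'0.
  rewrite [LHS](_ : _ = \int[lam]_k (f (k0 * k)%g * (rho (csg_val k))^-1)%:E)%E.
    move=> ->; apply: eq_integral => k _; congr _%:E; rewrite /f'.
    by field; rewrite !gt_eqF.
  apply: eq_integral => k _; rewrite /f' /x invgK.
  by rewrite (kh_partMl KHG kh_part _ _).1 (kpart_val KHG kh_part) mulKg.
have [c c0 cP] := haar_unique hK lcK haarK lamfin crhoV rhoV0 lam_inv.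
have main (phi : K -> R) : Cc phi -> (forall k, 0 <= phi k) ->
  (\int[lam]_k (phi k)%:E = \int[muK]_k (phi k * (c * rho (csg_val k)))%:E)%E.
  move=> Cphi phi0.
  have Cphir : Cc (fun k => phi k * rho (csg_val k)) by exact: Cc_mul.
  have phir0 k : 0 <= phi k * rho (csg_val k) by rewrite mulr_ge0// ltW.
  have := cP _ Cphir phir0.
  rewrite [LHS](_ : _ = \int[lam]_k (phi k)%:E)%E => [->|]; last first.
    by apply: eq_integral => k _; rewrite mulfK ?gt_eqF.
  rewrite -[LHS]ge0_integralZl//; last 2 first.
  - exact: (mK Cphir.1).
  - by move=> k _; rewrite lee_fin.
  by apply: eq_integral => k _; rewrite -EFinM mulrCA.
(* If c were 0, lam would vanish on C_c and the G-integral of phi(k_y) psi(h_y) rho(y) would be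
   zero, although this continuous nonnegative function is positive at 1. *)
exists c => //; rewrite lt0r c0 andbT; apply/eqP => cE.
have [phi [Cphi phi0 _ phi1]] := Cc_bump R hK lcK (filterT : nbhs (1%g : K) setT).
have [psi [Cpsi psi0 _ psi1]] := Cc_bump R hH lcH (filterT : nbhs (1%g : H) setT).
have := rho_measure_tensor 1%g Cphi Cpsi phi0 psi0.
rewrite [X in _ = fine X * _](_ : _ = 0)%E; last first.
  rewrite [LHS](_ : _ = \int[lam]_k (phi k)%:E)%E; last first.
    by apply: eq_integral => k _; rewrite mul1g (kpart_val KHG kh_part).
  by rewrite main// integral0_eq// => k _; rewrite cE mul0r mulr0.
rewrite mul0r; apply/eqP; rewrite gt_eqF// /Rintegral.
have Cf : Cc (fun y => phi (kpart y) * psi (hpart y) * rho y).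
  by apply: Cc_mul => //; exact: Cc_tensor.
have f0 y : 0 <= phi (kpart y) * psi (hpart y) * rho y by rewrite !mulr_ge0// ltW.
have f1 : 0 < phi (kpart 1%g) * psi (hpart 1%g) * rho 1%g.
  rewrite (_ : 1%g = csg_val (1%g : K))//.
  by rewrite (kpart_val KHG kh_part) (hpart_val KHG kh_part) !mulr_gt0.
under eq_integral do rewrite mul1g.
rewrite fine_gt0// (haar_integral_gt0 hG haarG Cf.1 f0 f1)/=.
by apply: Cc_integral_lty => // C; case: haarG => -[+ _] _ _; exact.
Qed.

End image_measure.

(** The equality on C_c passes to lower integrals through [transfer_Cc], with density c rho in one
    direction and its inverse in the other. In the second part c cancels, leaving quasi-invariance
    in terms of [muK]. *)
Lemma rho_measure_K : exists2 c : R, 0 < c &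
  (forall g : K -> \bar R, (forall k, 0 <= g k) ->
    \int[mu_rho]_w g (kpart (p w)) =
    \int[muK]_k (g k * (c * rho (csg_val k))%:E))%E /\
  forall x (phi : K -> R), Cc phi -> (forall k, 0 <= phi k) ->
   (\int[muK]_k (phi (kpart (x^-1 * csg_val k)%g) * rho (csg_val k))%:E =
    \int[muK]_k (phi k * rho (x * csg_val k)%g)%:E)%E.
Proof.
have [lam lamE] := borel_pushforward mu_rho (continuous_kpart_section KHG kh_part hp).
have [c c0 cP] := image_measure_haar lamE.
have lamreg := image_regular_borel lamE.
have muKreg : regular_borel muK by case: haarK.
have idc : continuous (@id K) by move=> k.
exists c => //; split => [g g0|x phi Cphi phi0].
  rewrite -(homeomorphism_integral (coset_hausdorff lcG KHG kh_part hp) hK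
    (continuous_kpart_section KHG kh_part hp) (@continuous_to_coset _ H K)
    (kpart_sectionK kh_part hp) (to_cosetK KHG kh_part hp) hmu_rho.1 lamE g0).
  have cv : continuous (fun k => c * rho (csg_val k)).
    by apply: (continuous_mulfun _ crhoK1); exact: cst_continuous.
  have v0 k : 0 < c * rho (csg_val k) by rewrite mulr_gt0.
  have cvV : continuous (fun k => (c * rho (csg_val k))^-1).
    by apply: continuous_invfun cv => k; rewrite gt_eqF.
  have vV0 k : 0 < (c * rho (csg_val k))^-1 by rewrite invr_gt0.
  apply/eqP; rewrite eq_le; apply/andP; split.
    apply: (@transfer_Cc R K K lam muK id id hK hK idc idc (fun=> erefl)
      (fun=> erefl) lamreg _ cv v0 lcK muKreg _ g g0) => phi Cphi phi0.
    by rewrite cP.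
  rewrite [leRHS](_ : _ = \int[lam]_k ((g k * (c * rho (csg_val k))%:E) *
      ((c * rho (csg_val k))^-1)%:E))%E; last first.
    apply: eq_integral => k _; rewrite -muleA -EFinM divff ?mule1//.
    by rewrite gt_eqF.
  apply: (@transfer_Cc R K K muK lam id id hK hK idc idc (fun=> erefl)
      (fun=> erefl) muKreg _ cvV vV0 lcK lamreg _
      (fun k => g k * (c * rho (csg_val k))%:E)%E) => [phi Cphi phi0|k]; last first.
    by rewrite mule_ge0// lee_fin ltW.
  rewrite cP//; last 2 first.
  - exact: Cc_mul.
  - by move=> k; rewrite mulr_ge0// ltW.
  by apply: ge0_le_integralT => k; rewrite lee_fin// divfK// gt_eqF.
have QI := image_quasi_invariant lamE x Cphi phi0.
have Cphix : Cc (fun k => phi (kpart (x^-1 * csg_val k)%g)).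
  apply: (Cc_comp hK (@cact x^-1%g) (@cact x)) => //.
  exact: (KactionVK KHG kh_part).
have Cphi2 : Cc (fun k => phi k * (rho (x * csg_val k)%g / rho (csg_val k))).
  apply: Cc_mul => //; apply: (continuous_mulfun (@crhoK x)).
  by apply: continuous_invfun crhoK1 => k; rewrite gt_eqF.
have phi20 k : 0 <= phi k * (rho (x * csg_val k)%g / rho (csg_val k)).
  by rewrite mulr_ge0// divr_ge0// ltW.
rewrite !cP// in QI.
have scale (f : K -> R) : Cc f -> (forall k, 0 <= f k) ->
    (\int[muK]_k (f k)%:E = c^-1%:E * \int[muK]_k (c * f k)%:E)%E.
  move=> Cf f0; rewrite -[RHS]ge0_integralZl//; last 3 first.
  - apply/measurable_EFinP; apply: measurable_funM => //.
    exact: (continuous_borel_realfun Cf.1).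
  - by move=> k _; rewrite lee_fin mulr_ge0// ltW.
  - by rewrite lee_fin invr_ge0 ltW.
  by apply: eq_integral => k _; rewrite -EFinM mulKf// gt_eqF.
rewrite scale; last 2 first.
- exact: Cc_mul.
- by move=> k; rewrite mulr_ge0// ltW.
rewrite [RHS]scale; last 2 first.
- by apply: Cc_mul => //; exact: crhoK.
- by move=> k; rewrite mulr_ge0// ltW.
congr (_ * _)%E; under eq_integral do rewrite mulrCA.
rewrite QI; apply: eq_integral => k _; congr _%:E.
by field; rewrite gt_eqF.
Qed.

(** The Radon-Nikodym density, with respect to [muK], of the image of [muK] under k |-> x . k;
    [sigma_integral] establishes this. *)
Let a x k := DeltaH (hpart (x^-1 * csg_val k)%g) /
  DeltaG (csg_val (hpart (x^-1 * csg_val k)%g)).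

(** The rho-function identity applied to y = k_y h_y. In this form positivity, continuity and the
    cocycle identity follow from rho. *)
Lemma sigma_densityE x k :
  a x k = rho (x^-1 * csg_val k)%g / rho (csg_val (kpart (x^-1 * csg_val k)%g)).
Proof.
have [_ _ rhoM] := hrho; rewrite /a; set y := (x^-1 * _)%g.
have := rhoM (csg_val (kpart y)) (hpart y).
by rewrite -kh_part => ->; rewrite mulfK// gt_eqF.
Qed.

Lemma sigma_density_gt0 x k : 0 < a x k.
Proof. by rewrite sigma_densityE divr_gt0. Qed.

Lemma sigma_density_cocycle x y k :
  a (x * y)%g k = a x k * a y (kpart (x^-1 * csg_val k)%g).
Proof.
rewrite !sigma_densityE invgM -!mulgA -(kh_partM KHG kh_part y^-1%g _).1.
set u := (x^-1 * _)%g.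
have -> : rho (y^-1 * u)%g =
    rho (y^-1 * csg_val (kpart u))%g / rho (csg_val (kpart u)) * rho u.
  by rewrite -rho_ratio divfK// gt_eqF.
by field; rewrite !gt_eqF.
Qed.

Lemma sigma_density1 k : a 1%g k = 1.
Proof.
rewrite sigma_densityE invg1 mul1g (kpart_val KHG kh_part) divff//.
by rewrite gt_eqF.
Qed.

Lemma sigma_densityV x k : a x (kpart (x * csg_val k)%g) * a x^-1%g k = 1.
Proof.
have := sigma_density_cocycle x^-1%g x k.
by rewrite mulVg sigma_density1 invgK mulrC => <-.
Qed.

(** The inequality [le] holds for every z. Taken at x^-1, with the left integrand in the role of f,
    it is the reverse inequality, because the densities of x and x^-1 cancel. *)
Lemma sigma_integral x (g : K -> \bar R) : (forall k, 0 <= g k)%E ->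
  (\int[muK]_k (g (kpart (x^-1 * csg_val k)%g) * (a x k)%:E) =
   \int[muK]_k g k)%E.
Proof.
have [c c0 [_ QI]] := rho_measure_K.
have muKreg : regular_borel muK by case: haarK.
have crhoxV z : continuous (fun k => (rho (csg_val (kpart (z * csg_val k)%g)))^-1).
  apply: continuous_invfun; first by move=> k; rewrite gt_eqF.
  exact: (cont_comp (@cact z) crhoK1).
have le z (f : K -> \bar R) : (forall k, 0 <= f k)%E ->
    (\int[muK]_k (f (kpart (z^-1 * csg_val k)%g) * (a z k)%:E) <=
     \int[muK]_k f k)%E.
  move=> f0.
  have av0 k : 0 < a z^-1%g k by exact: sigma_density_gt0.
  have cav : continuous (a z^-1%g).
    rewrite (_ : a z^-1%g = fun k => rho (z * csg_val k)%g *
        (rho (csg_val (kpart (z * csg_val k)%g)))^-1).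
      exact: continuous_mulfun.
    by apply/funext => k; rewrite sigma_densityE invgK.
  have := @transfer_Cc R K K muK muK (fun k => kpart (z^-1 * csg_val k)%g)
    (fun k => kpart (z * csg_val k)%g) hK hK (@cact z^-1%g) (@cact z)
    (KactionVK KHG kh_part z) (KactionK KHG kh_part z) muKreg _ cav av0 lcK muKreg.
  (* The integrand must be a function of z^-1 . k alone, so the density a z k is rewritten through k
     = z . (z^-1 . k). *)
  move=> /(_ _ (fun k => f k * (a z (kpart (z * csg_val k)%g))%:E)%E) tr.
  rewrite [leLHS](_ : _ = \int[muK]_k (f (kpart (z^-1 * csg_val k)%g) *
      (a z (kpart (z * csg_val (kpart (z^-1 * csg_val k)%g))%g))%:E))%E; last first.
    by apply: eq_integral => k _; rewrite (KactionVK KHG kh_part z k).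
  apply: le_trans (tr _ _) _.
  - move=> phi Cphi phi0.
    (* After the substitution the divisor rho(z . k) becomes rho(k) and cancels the weight on the
       left of [QI]. *)
    have Cphi' : Cc (fun k => phi k * (rho (csg_val (kpart (z * csg_val k)%g)))^-1).
      exact: Cc_mul.
    have phi'0 k : 0 <= phi k * (rho (csg_val (kpart (z * csg_val k)%g)))^-1.
      by rewrite mulr_ge0// invr_ge0 ltW.
    have := QI z _ Cphi' phi'0.
    rewrite [LHS](_ : _ = \int[muK]_k (phi (kpart (z^-1 * csg_val k)%g))%:E)%E.
      move=> ->; apply: ge0_le_integralT => k.
        by rewrite lee_fin mulr_ge0// ltW.
      by rewrite sigma_densityE invgK mulrAC -mulrA.
    apply: eq_integral => k _; rewrite (KactionVK KHG kh_part z k) divfK//.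
    by rewrite gt_eqF.
  - by move=> k; rewrite mule_ge0// lee_fin ltW// sigma_density_gt0.
  - apply: ge0_le_integralT => k.
      by rewrite !mule_ge0// lee_fin ltW// sigma_density_gt0.
    by rewrite -muleA -EFinM sigma_densityV mule1.
move=> g0; apply/eqP; rewrite eq_le le//=.
have := le x^-1%g (fun k => g (kpart (x^-1 * csg_val k)%g) * (a x k)%:E)%E.
rewrite [X in (_ -> X <= _)%E](_ : _ = \int[muK]_k g k)%E.
  by apply=> k; rewrite mule_ge0// lee_fin ltW// sigma_density_gt0.
apply: eq_integral => k _; rewrite invgK (KactionK KHG kh_part x k).
by rewrite -muleA -EFinM sigma_densityV mule1.
Qed.

End quasi_invariance.

(** * Weak measurability *)

Section hilbert.
Context (R : realType) (V : completeNormedModType R[i]).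
Variable ip : {dot V for Num.conj}.
Hypothesis hip : hilbert_inner ip.
Implicit Types u v w : V.

Definition rip u v : R := complex.Re (ip u v).

Let ReZ (a : R) (x : R[i]) : complex.Re (a%:C%C * x) = a * complex.Re x.
Proof. by case: x => [b c] /=; rewrite mul0r subr0. Qed.

Lemma ipZ (a : R) u v : ip (a%:C%C *: u) v = a%:C%C * ip u v /\
  ip u (a%:C%C *: v) = a%:C%C * ip u v.
Proof.
split; first by rewrite -[a%:C%C *: u]addr0 linearPl linear0l addr0.
rewrite -[a%:C%C *: v]addr0 linearPr linear0r addr0 /=; congr (_ * _).
exact: (conjc_real a).
Qed.

Lemma ripC u v : rip u v = rip v u.
Proof.
rewrite /rip [in LHS]hermC expr0 mul1r.
have -> : forall z : R[i], complex.Re (Num.conj z) = complex.Re z by case.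
by [].
Qed.

Lemma rip_norm u : rip u u = normR u ^+ 2.
Proof.
rewrite /rip hip /normR; have := normr_ge0 u.
case: `|u| => a b; rewrite lecE /= => /andP[/eqP -> _].
by rewrite mulr0 subr0.
Qed.

Lemma normR_ge0 u : 0 <= normR u.
Proof.
by rewrite /normR; have := normr_ge0 u; rewrite lecE => /andP[].
Qed.

Lemma ripB_norm u v : normR (u - v) ^+ 2 = normR u ^+ 2 - 2 * rip u v + normR v ^+ 2.
Proof.
have := ripC u v; rewrite -!rip_norm /rip linearBl !linearBr/=.
case: (ip u u) (ip u v) (ip v u) (ip v v) => [? ?] [? ?] [? ?] [? ?] /= ->.
by ring.
Qed.

Lemma normRB u v : normR (u - v) = normR (v - u).
Proof. by rewrite /normR distrC. Qed.

Lemma ripBr u v w : rip u (v - w) = rip u v - rip u w.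
Proof.
by rewrite /rip linearBr/=; case: (ip u v) (ip u w) => [? ?] [? ?].
Qed.

(** Antilinearity in the second argument reduces questions on imaginary parts to real parts. *)
Lemma rip_Im u v : complex.Im (ip u v) = rip u ('i%C *: v).
Proof.
rewrite /rip -['i%C *: v]addr0 linearPr linear0r addr0 /=.
by case: (ip u v) => a b /=; rewrite mul0r mulN1r sub0r opprK.
Qed.

(** A weak Cauchy-Schwarz inequality, read off from |e u - v|^2 >= 0 and |e u + v|^2 >= 0. *)
Lemma rip_small u v (e : R) : 0 < e -> normR v <= e ->
  `|rip u v| <= e * (normR u ^+ 2 + 1) / 2.
Proof.
move=> e0 ve.
have nonneg s : 0 <= e ^+ 2 * normR u ^+ 2 - 2 * (e * s * rip u v) +
    s ^+ 2 * normR v ^+ 2.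
  have := sqr_ge0 (normR ((e%:C)%C *: u - (s%:C)%C *: v)).
  rewrite ripB_norm -!rip_norm /rip !(ipZ _ _ _).1 !(ipZ _ _ _).2 !ReZ.
  move=> h; apply: le_trans h _; rewrite le_eqVlt; apply/orP; left; apply/eqP.
  by ring.
have v2 : normR v ^+ 2 <= e ^+ 2 by rewrite lerXn2r// nnegrE ?normR_ge0// ltW.
rewrite ler_norml; apply/andP; split.
  have := nonneg (-1); rewrite sqrrN expr1n => h.
  rewrite -(ler_pM2l e0); nra.
have := nonneg 1; rewrite expr1n => h.
rewrite -(ler_pM2l e0); nra.
Qed.

Lemma normRZ (a : R) u : 0 <= a -> normR ((a%:C)%C *: u) = a * normR u.
Proof.
move=> a0; apply/eqP; rewrite -(@eqrXn2 _ 2) ?normR_ge0 ?mulr_ge0 ?normR_ge0//.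
rewrite -rip_norm /rip (ipZ _ _ _).1 (ipZ _ _ _).2 !ReZ -/(rip u u).
by rewrite rip_norm mulrA exprMn.
Qed.

(** Norm continuity with real tolerances; the norm of V itself takes values in R[i]. *)
Definition normR_continuous (Y : topologicalType) (f : Y -> V) :=
  forall y0 (e : R), 0 < e -> \forall y \near y0, normR (f y - f y0) < e.

(* On a compact set, a norm-continuous function is a uniform limit of functions
   taking finitely many values on Borel pieces. *)
Lemma measurable_rip (X Y : ptopologicalType) (F : X -> V) (T : Y -> X)
    (f : Y -> V) (C : set Y) :
  hausdorff_space X -> hausdorff_space Y -> weakly_measurable ip F -> continuous T ->
  normR_continuous f -> compact C ->
  measurable_fun (C : set (borel Y)) (fun y => rip (F (T y)) (f y)).
Proof.
move=> hX hY wF cT cf cC; have mC := compact_borel hY cC.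
(* Weak measurability speaks only of compact sets, so F is tested on the compact set T(C). *)
have mcst eta : measurable_fun (C : set (borel Y)) (fun y => rip (F (T y)) eta).
  move=> _ A mA.
  have cTC : compact (T @` C) by exact: continuous_image_compact.
  have mF : measurable (T @` C `&` (fun x => rip (F x) eta) @^-1` A : set (borel X)).
    exact: ((wF eta _ cTC).1 (compact_borel hX cTC) A mA).
  rewrite (_ : _ `&` _ = C `&` T @^-1` (T @` C `&` (fun x => rip (F x) eta) @^-1` A)).
    by apply: measurableI => //; exact: (preimage_borel cT).
  apply/seteqP; split => [y [Cy Ay]|y [Cy [_ Ay]]]; last by split.
  by split => //; split => //; exists y.
pose B n (a : Y) := [set y | normR (f y - f a) < n.+1%:R^-1]°.
(* The first center in the list whose neighborhood contains y; on C, with the covering list D n, the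
   default [point] is never reached. *)
pose sel n := fix sel (s : seq Y) y :=
  if s is a :: s' then if `[< B n a y >] then a else sel s' y else point.
have oB n a : open (B n a) by exact: open_interior.
have BP n a : B n a a by apply: cf; rewrite invr_gt0.
have cov n : finite_subset_cover C (B n) C.
  by apply: compact_fset_cover => // y Cy; exists y.
have /choice[D DP] : forall n, exists s : seq Y,
    C `<=` (fun y => exists2 a, a \in s & B n a y).
  move=> n; have [D _ CD] := cov n; exists (enum_fset D) => y Cy.
  by have [a aD Ba] := CD y Cy; exists a.
have selP n s y : (exists2 a, a \in s & B n a y) ->
    normR (f (sel n s y) - f y) < n.+1%:R^-1.
  elim: s => [[a]//|b s IH [a as_ Bay]] /=.
  case: asboolP => [/interior_subset/= Bby|nB].
    by rewrite normRB.
  apply: IH; exists a => //; move: as_; rewrite inE => /orP[/eqP ab|//].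
  by case: nB; rewrite -ab.
have msel n s : measurable_fun (C : set (borel Y))
    (fun y => rip (F (T y)) (f (sel n s y))).
  elim: s => [|b s IH] /=; first exact: mcst.
  rewrite (_ : (fun y => _) = (fun y => if `[< B n b y >] then rip (F (T y)) (f b)
     else rip (F (T y)) (f (sel n s y)))); last by apply/funext => y; case: asboolP.
  have mB : measurable_fun (C : set (borel Y)) (fun y => `[< B n b y >]).
    apply: (measurable_fun_bool true); apply: measurableI => //.
    rewrite (_ : _ @^-1` _ = B n b); last by apply/seteqP; split => y /= /asboolP.
    exact: open_borel.
  apply: measurable_fun_if => //; first by apply: measurable_funS (mcst (f b)).
  by apply: measurable_funS IH.
apply: (@measurable_fun_cvg _ (borel Y) R C
  (fun n y => rip (F (T y)) (f (sel n (D n) y)))).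
  by move=> n; exact: msel.
move=> y Cy; apply/cvgrPdist_lt => e e0.
set c := normR (F (T y)) ^+ 2 + 1.
have c0 : 0 < c by rewrite ltr_wpDl// sqr_ge0.
have ec0 : 0 < e / c by rewrite divr_gt0.
near=> n.
have sn := selP n (D n) y (DP n y Cy).
have : n.+1%:R^-1 < e / c by near: n; exact: (near_infty_natSinv_lt (PosNum ec0)).
rewrite ltr_pdivlMr// => ne.
rewrite -ripBr.
have n0 : 0 < n.+1%:R^-1 :> R by rewrite invr_gt0.
rewrite normRB in sn.
apply: le_lt_trans (rip_small (F (T y)) n0 (ltW sn)) _.
rewrite -/c; apply: le_lt_trans ne; rewrite ler_pdivrMr//.
by rewrite ler_pMr ?mulr_gt0// ler1n.
Unshelve. all: by end_near. Qed.

Section unitary_representation.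
Context (H : topGroupType) (pi : H -> V -> V).
Hypothesis hpi : unitary_rep ip pi.

Lemma rep1 v : pi 1%g v = v.
Proof.
have [_ _ surj mor _] := hpi; have [u <-] := surj 1%g v.
by rewrite -mor mul1g.
Qed.

Lemma repM h h' v : pi (h * h')%g v = pi h (pi h' v).
Proof. by case: hpi => _ _ _ + _; exact. Qed.

Lemma repVK h : cancel (pi h) (pi h^-1%g).
Proof. by move=> v; rewrite -repM mulVg rep1. Qed.

Lemma repP h (a : R[i]) u v : pi h (a *: u + v) = a *: pi h u + pi h v.
Proof. by case: hpi => + _ _ _ _; exact. Qed.

Lemma repZ h (a : R[i]) u : pi h (a *: u) = a *: pi h u.
Proof.
have pi0 : pi h 0 = 0.
  by have := repP h 1 0 0; rewrite scaler0 addr0 scale1r -{1}[pi h 0]addr0 => /addrI <-.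
by rewrite -[a *: u]addr0 repP pi0 addr0.
Qed.

Lemma rep_ip h u v : ip (pi h u) (pi h v) = ip u v.
Proof. by case: hpi => _ + _ _ _; exact. Qed.

Lemma rep_ip_adj h u v : ip (pi h^-1%g u) v = ip u (pi h v).
Proof. by rewrite -(rep_ip h) -repM mulgV rep1. Qed.

Lemma rep_norm h u : normR (pi h u) = normR u.
Proof.
apply/eqP; rewrite -(@eqrXn2 _ 2) ?normR_ge0//.
by rewrite -!rip_norm /rip rep_ip.
Qed.

(* |pi h eta - pi h0 eta|^2 = 2 |eta|^2 - 2 Re <pi h eta, pi h0 eta>. *)
Lemma rep_normR_continuous (eta : V) : normR_continuous (fun h => pi h eta).
Proof.
move=> h0 e e0; have [_ _ _ _ wc] := hpi.
have e2 : 0 < e ^+ 2 / 2 by rewrite divr_gt0// exprn_gt0.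
have := wc (pi h0 eta) eta h0; move=> /cvgrPdist_lt /(_ ((e ^+ 2 / 2)%:C%C)).
rewrite ltcR => /(_ e2); apply: filterS => h.
move=> /(le_lt_trans (normc_ge_Re _)); rewrite ltcR.
have -> : complex.Re (ip (pi h0 eta) (pi h0 eta) - ip (pi h0 eta) (pi h eta)) =
    normR eta ^+ 2 - rip (pi h eta) (pi h0 eta).
  rewrite ripC -(rep_norm h0) -rip_norm /rip.
  case: (ip (pi h0 eta) (pi h0 eta)) => ? ?.
  by case: (ip (pi h0 eta) (pi h eta)).
have := ripB_norm (pi h eta) (pi h0 eta); rewrite !rep_norm => nE.
rewrite ltr_norml => /andP[_ h2].
have : normR (pi h eta - pi h0 eta) ^+ 2 < e ^+ 2 by rewrite nE; lra.
by rewrite ltr_pXn2r// ?nnegrE ?normR_ge0 ?(ltW e0).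
Qed.

(** Unitarity moves the operator to the fixed vector: <pi(h^-1) F, eta> = <F, pi(h) eta>, and pi(h)
    eta is norm-continuous in h. *)
Lemma weakly_measurable_rep (X Y : ptopologicalType) (F : X -> V) (T : Y -> X)
    (hh : Y -> H) (c : Y -> R) :
  hausdorff_space X -> hausdorff_space Y -> weakly_measurable ip F ->
  continuous T -> continuous hh -> continuous c ->
  weakly_measurable ip (fun y => ((c y)%:C)%C *: pi ((hh y)^-1)%g (F (T y))).
Proof.
move=> hX hY wF cT ch cc.
suff mre eta (C : set Y) : compact C -> measurable_fun (C : set (borel Y))
    (fun y => rip (((c y)%:C)%C *: pi ((hh y)^-1)%g (F (T y))) eta).
  move=> eta C cC; split; first exact: mre.
  by under eq_fun do rewrite rip_Im; exact: mre.
move=> cC.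
under eq_fun do rewrite /rip (ipZ _ _ _).1 ReZ rep_ip_adj -/(rip _ _).
apply: measurable_funM.
  by apply: measurable_funTS; exact: continuous_borel_realfun.
apply: measurable_rip => // y0 e e0.
have := rep_normR_continuous eta (hh y0) e0.
exact: ch.
Qed.

Lemma rep_scale_ip (c : R) h u v :
  ip (c%:C%C *: pi h u) (c%:C%C *: pi h v) = (c ^+ 2)%:C%C * ip u v.
Proof.
by rewrite (ipZ _ _ _).1 (ipZ _ _ _).2 rep_ip mulrA -rmorphM expr2.
Qed.

End unitary_representation.

End hilbert.

(** * The unitary equivalence *)

Section change_of_variables.
Context (R : realType) (S S1 S2 : ptopologicalType).
Variables (m1 : {measure set (borel S1) -> \bar R}).
Variables (m2 : {measure set (borel S2) -> \bar R}).
Variables (T1 : S1 -> S) (T2 : S2 -> S) (b : S2 -> R).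
Hypothesis b0 : forall x, 0 <= b x.
Hypothesis change : forall g : S -> \bar R, (forall y, 0 <= g y)%E ->
  (\int[m1]_x g (T1 x) = \int[m2]_x (g (T2 x) * (b x)%:E))%E.

(** Multiplication by b >= 0 commutes with positive and negative parts, so the identity for
    nonnegative functions applies to each part. *)
Lemma change_of_variables (f : S -> R) :
  (\int[m1]_x (f (T1 x))%:E = \int[m2]_x (b x * f (T2 x))%:E)%E.
Proof.
have pos : ((fun x => (b x * f (T2 x))%:E)^\+ =
    fun x => (EFin \o f)^\+ (T2 x) * (b x)%:E)%E.
  apply/funext => x; rewrite !funeposE/= -!EFin_max -EFinM; congr _%:E.
  by rewrite mulrC maxr_pMl// mul0r mulrC.
have neg : ((fun x => (b x * f (T2 x))%:E)^\- =
    fun x => (EFin \o f)^\- (T2 x) * (b x)%:E)%E.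
  apply/funext => x; rewrite !funenegE/= -!EFin_max -EFinM; congr _%:E.
  by rewrite mulrC maxr_pMl// mul0r mulNr.
rewrite integralE [RHS]integralE pos neg.
have p0 y : (0 <= (EFin \o f)^\+ y)%E by exact: funepos_ge0.
have n0 y : (0 <= (EFin \o f)^\- y)%E by exact: funeneg_ge0.
rewrite -(change p0) -(change n0); congr (_ - _)%E;
  by apply: eq_integral => x _; rewrite ?funeposE ?funenegE.
Qed.

Lemma complex_change_of_variables (f : S -> R[i]) :
  complex_integral m1 (fun x => f (T1 x)) =
  complex_integral m2 (fun x => (b x)%:C%C * f (T2 x)).
Proof.
have ReE (r : R) (z : R[i]) : complex.Re (r%:C%C * z) = r * complex.Re z.
  by case: z => ? ? /=; rewrite mul0r subr0.
have ImE (r : R) (z : R[i]) : complex.Im (r%:C%C * z) = r * complex.Im z.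
  by case: z => ? ? /=; rewrite mul0r addr0.
rewrite /complex_integral /Rintegral; congr Complex; congr fine.
  under [RHS]eq_integral do rewrite ReE.
  exact: (change_of_variables (fun y => complex.Re (f y))).
under [RHS]eq_integral do rewrite ImE.
exact: (change_of_variables (fun y => complex.Im (f y))).
Qed.

End change_of_variables.

Lemma negligible_preimage (R : realType) (X Y : ptopologicalType)
    (mu : {measure set (borel X) -> \bar R}) (nu : {measure set (borel Y) -> \bar R})
    (T : X -> Y) (b : Y -> R) (S : set Y) :
  continuous T -> (forall y, 0 <= b y) ->
  (forall g : Y -> \bar R, (forall y, 0 <= g y)%E ->
    \int[mu]_x g (T x) = \int[nu]_y (g y * (b y)%:E))%E ->
  nu.-negligible S -> mu.-negligible (T @^-1` S).
Proof.
move=> cT b0 change [M [mM M0 SM]].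
have mTM : measurable (T @^-1` M : set (borel X)) by exact: preimage_borel.
exists (T @^-1` M); split => //; last by move=> x /SM.
have := integral_indic mu measurableT mTM; rewrite setIT => <-.
rewrite (change (fun y => (\1_M y)%:E)); last by move=> y; rewrite lee_fin.
rewrite -(integral0 nu setT); apply: ae_ge0_eq_integralT => //.
  by move=> y; rewrite mule_ge0// lee_fin.
exists M; split => // y /= My; apply: contrapT => nMy; apply: My.
by rewrite indicE memNset// mul0e.
Qed.

Lemma ae_eq_integral_EFin (R : realType) (T : ptopologicalType)
    (mu : {measure set (borel T) -> \bar R}) (f g : T -> R) :
  {ae mu, forall x, f x = g x} -> (\int[mu]_x (f x)%:E = \int[mu]_x (g x)%:E)%E.
Proof.
move=> fg; apply: ae_eq_integralT; apply: negligibleS fg => x /= nx e.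
by apply: nx; rewrite e.
Qed.

Lemma ae_complex_integral (R : realType) (T : ptopologicalType)
    (mu : {measure set (borel T) -> \bar R}) (f g : T -> R[i]) :
  {ae mu, forall x, f x = g x} -> complex_integral mu f = complex_integral mu g.
Proof.
move=> fg; rewrite /complex_integral /Rintegral.
by congr (Complex (fine _) (fine _)); apply: ae_eq_integralT;
  apply: negligibleS fg => x /= nx e; apply: nx; rewrite e.
Qed.

Section equivalence.
Context (R : realType) (G : topGroupType) (H K : closed_subgroup G).
Hypothesis lcG : locally_compact_group G.
Hypothesis KHG : homeomorphism
  (fun kh : K * H => (csg_val kh.1 * csg_val kh.2)%g).
Variables (kpart : G -> K) (hpart : G -> H).
Hypothesis kh_part :
  forall x : G, x = (csg_val (kpart x) * csg_val (hpart x))%g.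
Variables (muG : {measure set (borel G) -> \bar R}).
Variables (muH : {measure set (borel H) -> \bar R}).
Variables (muK : {measure set (borel K) -> \bar R}).
Hypotheses (haarG : left_haar muG) (haarH : left_haar muH).
Hypothesis haarK : left_haar muK.
Variables (DeltaG : G -> R) (DeltaH : H -> R) (rho : G -> R).
Hypothesis hrho : rho_function DeltaG DeltaH rho.
Variable p : coset_space H -> G.
Variable mu_rho : {measure set (borel (coset_space H)) -> \bar R}.
Hypothesis hp : cross_section p.
Hypothesis hmu_rho : rho_measure muG muH rho p mu_rho.
Variables (V : completeNormedModType R[i]) (ip : {dot V for Num.conj}).
Hypothesis hip : hilbert_inner ip.
Variable pi : H -> V -> V.
Hypothesis hpi : unitary_rep ip pi.
Implicit Types (x y : G) (k : K) (h : H) (xi : G -> V).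

Let hG : hausdorff_space G. Proof. by case: lcG. Qed.
Let hK : hausdorff_space K. Proof. exact: csg_hausdorff. Qed.
Let ckpart : continuous kpart. Proof. exact: (continuous_kpart KHG kh_part). Qed.
Let chpart : continuous hpart. Proof. exact: (continuous_hpart KHG kh_part). Qed.
Let crho : continuous rho. Proof. by case: hrho. Qed.
Let rho0 x : 0 < rho x. Proof. by case: hrho => _ + _. Qed.
Let cont_comp (S T U : topologicalType) (f : S -> T) (g : T -> U) :
  continuous f -> continuous g -> continuous (fun s => g (f s)).
Proof. by move=> cf cg s; apply: continuous_comp; [exact: cf|exact: cg]. Qed.
Let csqrt (S : topologicalType) (f : S -> R) : continuous f ->
  continuous (fun s => Num.sqrt (f s)).
Proof. by move=> cf; apply: (cont_comp cf); exact: sqrt_continuous. Qed.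

Variable c : R.
Hypothesis c0 : 0 < c.
Hypothesis mu_rhoE : forall g : K -> \bar R, (forall k, 0 <= g k)%E ->
  (\int[mu_rho]_w g (kpart (p w)) =
   \int[muK]_k (g k * (c * rho (csg_val k))%:E))%E.

Let a x k := DeltaH (hpart (x^-1 * csg_val k)%g) /
  DeltaG (csg_val (hpart (x^-1 * csg_val k)%g)).
Let a0 x k : 0 < a x k. Proof. exact: (sigma_density_gt0 kh_part hrho). Qed.

Let aM x y k : a (x * y)%g k = a x k * a y (kpart (x^-1 * csg_val k)%g).
Proof. exact: (sigma_density_cocycle KHG kh_part hrho). Qed.

Let sigma := sigma_action pi DeltaG DeltaH kpart hpart.
Let A := ind_space ip pi muG p mu_rho.
Let B := L2 ip muK.

Definition covariant xi :=
  {ae muG, forall x, forall h, xi (x * csg_val h)%g = pi (h^-1)%g (xi x)}.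

Lemma negligible_translate x (S : set G) :
  muG.-negligible S -> muG.-negligible [set y | S (x^-1 * y)%g].
Proof.
have [_ _ inv] := haarG; move=> [M [mM M0 SM]].
have E : [set (x * y)%g | y in M] = (fun y => x^-1 * y)%g @^-1` M.
  apply/seteqP; split => [_ [y My <-]|y My] /=; first by rewrite mulKg.
  by exists (x^-1 * y)%g => //; rewrite mulVKg.
exists [set (x * y)%g | y in M]; split; [|by rewrite -M0; exact: inv|].
  by rewrite E; apply: (preimage_borel _ mM); exact: continuous_mulgl.
by move=> y /SM; rewrite E.
Qed.

(** The action of x on K is in general not a translation of K, but it lifts to left translation on
    G, where invariance of [muG] preserves null sets. *)
Lemma negligible_Kaction x (S : set K) : muK.-negligible S ->
  muK.-negligible [set k | S (kpart (x^-1 * csg_val k)%g)].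
Proof.
move=> /(negligible_kpart lcG KHG kh_part haarG haarK)/(negligible_translate x) Sx.
apply: (kpart_negligible lcG KHG kh_part haarG haarK).
apply: negligibleS Sx => y /=.
by rewrite -(kh_partM KHG kh_part x^-1%g y).1.
Qed.

Lemma negligible_coset (S : set K) : muK.-negligible S ->
  mu_rho.-negligible [set w | S (kpart (p w))].
Proof.
apply: (negligible_preimage (continuous_kpart_section KHG kh_part hp) _ mu_rhoE).
by move=> k; rewrite mulr_ge0// ltW.
Qed.

(** Covariance at x for all h gives covariance at k_x = x h_x^-1, so the exceptional subset of K
    pulls back into that of G. *)
Lemma covariant_K xi : covariant xi -> {ae muK, forall k, forall h,
  xi (csg_val k * csg_val h)%g = pi (h^-1)%g (xi (csg_val k))}.
Proof.
move=> cov; apply: (kpart_negligible lcG KHG kh_part haarG haarK).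
apply: negligibleS cov => x /= nk cx; apply: nk => h.
have kE : csg_val (kpart x) = (x * csg_val (hpart x)^-1)%g.
  by rewrite {2}(kh_part x) mulgK.
rewrite kE -mulgA (cx ((hpart x)^-1)%g) -(repM hpi).
have := cx ((hpart x)^-1 * h)%g => ->; congr (pi _ _).
by rewrite !invgM.
Qed.

Lemma covariant_coset xi : covariant xi -> {ae mu_rho, forall w,
  xi (p w) = pi ((hpart (p w))^-1)%g (xi (csg_val (kpart (p w))))}.
Proof.
move=> /covariant_K/negligible_coset; apply: negligibleS => w /= nw cw.
by apply: nw; rewrite -cw -kh_part.
Qed.

(** By covariance and unitarity p(w) may be replaced by its K-part; the integrand is then a function
    on K, to which [mu_rhoE] applies. *)
Lemma ind_ipE xi1 xi2 : covariant xi1 -> covariant xi2 ->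
  complex_integral mu_rho (fun w => ip (xi1 (p w)) (xi2 (p w))) =
  complex_integral muK (fun k => (c * rho (csg_val k))%:C%C *
    ip (xi1 (csg_val k)) (xi2 (csg_val k))).
Proof.
move=> cov1 cov2.
rewrite (@ae_complex_integral _ _ _ _ (fun w =>
   ip (xi1 (csg_val (kpart (p w)))) (xi2 (csg_val (kpart (p w)))))); last first.
  have := negligibleU (covariant_coset cov1) (covariant_coset cov2).
  apply: negligibleS => w /= nw.
  apply: contrapT => /not_orP[/contrapT e1 /contrapT e2]; apply: nw.
  by rewrite e1 e2 (rep_ip hpi).
apply: (complex_change_of_variables (T1 := fun w => kpart (p w)) (T2 := id) _ mu_rhoE
  (fun k => ip (xi1 (csg_val k)) (xi2 (csg_val k)))).
by move=> k; rewrite mulr_ge0// ltW.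
Qed.

Lemma ind_normE xi : covariant xi ->
  (\int[mu_rho]_w (normR (xi (p w)) ^+ 2)%:E =
   \int[muK]_k (c * rho (csg_val k) * normR (xi (csg_val k)) ^+ 2)%:E)%E.
Proof.
move=> cov.
transitivity (\int[mu_rho]_w (normR (xi (csg_val (kpart (p w)))) ^+ 2)%:E)%E.
  apply: ae_eq_integral_EFin.
  apply: negligibleS (covariant_coset cov) => w /= nw e.
  by apply: nw; rewrite e (rep_norm hip hpi).
rewrite (mu_rhoE (g := fun k => (normR (xi (csg_val k)) ^+ 2)%:E)).
  by apply: eq_integral => k _; rewrite -EFinM mulrC.
by move=> k; rewrite lee_fin sqr_ge0.
Qed.

Lemma ind_aeE xi1 xi2 : covariant xi1 -> covariant xi2 ->
  {ae muG, forall x, xi1 x = xi2 x} <->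
  {ae muK, forall k, xi1 (csg_val k) = xi2 (csg_val k)}.
Proof.
move=> /covariant_K cov1 /covariant_K cov2; split => [e|e].
  have [n1 n2] := (negligible_kpart lcG KHG kh_part haarG haarK cov1,
    negligible_kpart lcG KHG kh_part haarG haarK cov2).
  apply: (kpart_negligible lcG KHG kh_part haarG haarK).
  have := negligibleU (negligibleU n1 n2) e; apply: negligibleS => x /= ne.
  apply: contrapT => /not_orP[/not_orP[/contrapT g1 /contrapT g2] /contrapT xe].
  apply: ne; apply: (can_inj (repVK hpi ((hpart x)^-1)%g)).
  by rewrite -g1 -g2 -kh_part.
have := negligible_kpart lcG KHG kh_part haarG haarK
  (negligibleU (negligibleU cov1 cov2) e).
apply: negligibleS => x /= ne.
apply: contrapT => /not_orP[/not_orP[/contrapT g1 /contrapT g2] /contrapT xe].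
by apply: ne; rewrite (kh_part x) g1 g2 xe.
Qed.

Lemma scale_rep_inj (r : R) h : 0 < r -> injective (fun v => r%:C%C *: pi h v).
Proof.
move=> r0 u v /= /scalerI uv; apply: (can_inj (repVK hpi h)); apply: uv.
by rewrite fmorph_eq0 gt_eqF.
Qed.

Lemma sigmaE x (F : K -> V) k : sigma x F k = (Num.sqrt (a x k))%:C%C *:
  pi ((hpart (x^-1 * csg_val k))^-1)%g (F (kpart (x^-1 * csg_val k)%g)).
Proof. by []. Qed.

Lemma sigma_aeE x (F1 F2 : K -> V) : {ae muK, forall k, sigma x F1 k = sigma x F2 k} <->
  {ae muK, forall k, F1 k = F2 k}.
Proof.
split => [/(negligible_Kaction x^-1%g)|/(negligible_Kaction x)];
    apply: negligibleS => k /= ne e; apply: ne; last by rewrite !sigmaE e.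
move: e; rewrite invgK !sigmaE (KactionK KHG kh_part x k).
by apply: scale_rep_inj; rewrite sqrtr_gt0.
Qed.

Lemma sigmaM x y (F : K -> V) k : sigma (x * y)%g F k = sigma x (sigma y F) k.
Proof.
rewrite !sigmaE (repZ hpi) scalerA -(repM hpi).
rewrite -rmorphM -sqrtrM ?(ltW (a0 _ _))// -aM.
rewrite !invgM -!mulgA.
have [kE hE] := kh_partM KHG kh_part y^-1%g (x^-1 * csg_val k)%g.
by rewrite kE hE invgM.
Qed.

Lemma sigma1 (F : K -> V) k : sigma 1%g F k = F k.
Proof.
rewrite sigmaE /a (sigma_density1 KHG kh_part hrho) sqrtr1 scale1r invg1 mul1g.
by rewrite (kpart_val KHG kh_part) (hpart_val KHG kh_part) invg1 (rep1 hpi).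
Qed.

Lemma sigma_integrable x (F : K -> V) :
  (\int[muK]_k (normR (sigma x F k) ^+ 2)%:E =
   \int[muK]_k (normR (F k) ^+ 2)%:E)%E.
Proof.
rewrite -[RHS](sigma_integral lcG KHG kh_part haarG haarH haarK hrho hp hmu_rho x);
  last by move=> k; rewrite lee_fin sqr_ge0.
apply: eq_integral => k _; rewrite sigmaE (normRZ hip) ?sqrtr_ge0//.
by rewrite (rep_norm hip hpi) exprMn sqr_sqrtr ?(ltW (a0 _ _))// -EFinM mulrC.
Qed.

Lemma sigma_ip x (F1 F2 : K -> V) :
  complex_integral muK (fun k => ip (sigma x F1 k) (sigma x F2 k)) =
  complex_integral muK (fun k => ip (F1 k) (F2 k)).
Proof.
rewrite (@complex_change_of_variables _ _ _ _ muK muK id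
  (fun k => kpart (x^-1 * csg_val k)%g) (a x) _ _ (fun k => ip (F1 k) (F2 k))).
- congr (complex_integral _ _); apply/funext => k.
  by rewrite !sigmaE (rep_scale_ip hpi) sqr_sqrtr ?(ltW (a0 _ _)).
- by move=> k; exact: ltW.
- move=> g g0.
  by rewrite (sigma_integral lcG KHG kh_part haarG haarH haarK hrho hp hmu_rho).
Qed.

Let ca x : continuous (a x).
Proof.
rewrite (_ : a x = fun k => rho (x^-1 * csg_val k)%g *
    (rho (csg_val (kpart (x^-1 * csg_val k)%g)))^-1); last first.
  by apply/funext => k; exact: (sigma_densityE kh_part hrho).
have cl : continuous (fun k => (x^-1 * csg_val k)%g).
  by apply: (cont_comp (@csg_val_continuous _ K)); exact: continuous_mulgl.
apply: continuous_mulfun; first exact: (cont_comp cl crho).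
apply: continuous_invfun; first by move=> k; rewrite gt_eqF.
exact: (cont_comp (cont_comp (cont_comp cl ckpart) (@csg_val_continuous _ K)) crho).
Qed.

Lemma sigma_dom x F : fs_dom B F -> fs_dom B (sigma x F).
Proof.
move=> [wF iF]; split; last by rewrite sigma_integrable.
have cl : continuous (fun k => (x^-1 * csg_val k)%g).
  by apply: (cont_comp (@csg_val_continuous _ K)); exact: continuous_mulgl.
apply: (weakly_measurable_rep hip hpi hK hK wF (cont_comp cl ckpart)
  (cont_comp cl chpart)).
exact: (csqrt (@ca x)).
Qed.

Lemma sigma_unitary_action : unitary_action B sigma.
Proof.
split=> [x|x y F _]; last first.
  by apply: aeW => k; exact: sigmaM.
split.
- exact: sigma_dom.
- by move=> F1 F2 _ _; exact: sigma_aeE.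
- move=> z F1 F2 _ _; apply: aeW => k.
  by rewrite !sigmaE (repP hpi) scalerDr !scalerA mulrC.
- by move=> F1 F2 _ _; exact: sigma_ip.
- move=> F BF; exists (sigma x^-1%g F); first exact: sigma_dom.
  by apply: aeW => k; rewrite -sigmaM mulgV sigma1.
Qed.

Let s := @ind_action R V G rho.

Lemma ind_actionM x y xi z : s (x * y)%g xi z = s x (s y xi) z.
Proof.
have E : rho (y^-1 * (x^-1 * z))%g / rho z =
    rho (x^-1 * z)%g / rho z * (rho (y^-1 * (x^-1 * z))%g / rho (x^-1 * z)%g).
  by field; rewrite !gt_eqF.
rewrite /s /ind_action scalerA -rmorphM -sqrtrM ?divr_ge0 ?(ltW (rho0 _))//.
by rewrite invgM -mulgA E.
Qed.

Lemma ind_action1 xi z : s 1%g xi z = xi z.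
Proof. by rewrite /s /ind_action invg1 mul1g divff ?gt_eqF// sqrtr1 scale1r. Qed.

Lemma ind_action_aeE x xi1 xi2 :
  {ae muG, forall y, s x xi1 y = s x xi2 y} <-> {ae muG, forall y, xi1 y = xi2 y}.
Proof.
split => [/(negligible_translate x^-1%g)|/(negligible_translate x)];
    apply: negligibleS => y /= ne e; apply: ne; last by rewrite /s /ind_action e.
move: e; rewrite invgK /s /ind_action mulKg => /scalerI; apply.
by rewrite fmorph_eq0 gt_eqF// sqrtr_gt0 divr_gt0.
Qed.

Lemma ind_action_covariant x xi : covariant xi -> covariant (s x xi).
Proof.
move/(negligible_translate x); apply: negligibleS => y /= ne e; apply: ne => h.
have [_ _ rhoM] := hrho.
rewrite /s /ind_action mulgA e (repZ hpi) !rhoM; congr (_%:C%C *: _); congr Num.sqrt.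
set r := DeltaH h / _; rewrite -mulf_div divff ?mul1r//.
apply: contraTneq (rho0 (y * csg_val h)%g) => r0.
by rewrite rhoM -/r r0 mul0r ltxx.
Qed.

Lemma ind_action_weakly_measurable x xi :
  weakly_measurable ip xi -> weakly_measurable ip (s x xi).
Proof.
move=> wxi.
have cr : continuous (fun y => rho (x^-1 * y)%g / rho y).
  apply: continuous_mulfun; first exact: (cont_comp (@continuous_mulgl _ _) crho).
  by apply: continuous_invfun crho => y; rewrite gt_eqF.
have := weakly_measurable_rep hip hpi hG hG wxi (@continuous_mulgl _ x^-1%g)
  (@cst_continuous _ _ 1%g) (csqrt cr).
by congr weakly_measurable; apply/funext => y; rewrite invg1 (rep1 hpi).
Qed.

Definition restrict_K (xi : G -> V) : K -> V :=
  fun k => (Num.sqrt (c * rho (csg_val k)))%:C%C *: xi (csg_val k).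
Local Notation U := restrict_K.

Let crho0 k : 0 < c * rho (csg_val k). Proof. by rewrite mulr_gt0. Qed.

Lemma restrict_K_norm xi : covariant xi ->
  (\int[muK]_k (normR (U xi k) ^+ 2)%:E =
   \int[mu_rho]_w (normR (xi (p w)) ^+ 2)%:E)%E.
Proof.
move=> cov; rewrite ind_normE//; apply: eq_integral => k _.
by rewrite (normRZ hip) ?sqrtr_ge0// exprMn sqr_sqrtr ?(ltW (crho0 k)).
Qed.

Lemma restrict_K_ip xi1 xi2 : covariant xi1 -> covariant xi2 ->
  fs_ip B (U xi1) (U xi2) = fs_ip A xi1 xi2.
Proof.
move=> cov1 cov2; rewrite /= ind_ipE//; congr (complex_integral _ _).
apply/funext => k; rewrite /restrict_K (ipZ _ _ _ _).1 (ipZ _ _ _ _).2.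
by rewrite mulrA -rmorphM -expr2 sqr_sqrtr ?(ltW (crho0 k)).
Qed.

(** Covariance turns xi(x^-1 k) into pi applied to xi(x^-1 . k), and on both sides the scalar is the
    square root of c rho(x^-1 k). *)
Lemma restrict_K_intertwines x xi : covariant xi ->
  {ae muK, forall k, U (s x xi) k = sigma x (U xi) k}.
Proof.
move=> /covariant_K/(negligible_Kaction x).
apply: negligibleS => k /= ne e; apply: ne.
rewrite sigmaE /restrict_K /s /ind_action (repZ hpi) -e -kh_part !scalerA.
rewrite -!rmorphM -!sqrtrM ?(ltW (crho0 _)) ?(ltW (a0 _ _))//.
rewrite {1}/a (sigma_densityE kh_part hrho).
congr (_%:C%C *: _); congr Num.sqrt.
by field; rewrite !gt_eqF.
Qed.

Let csq : continuous (fun k => Num.sqrt (c * rho (csg_val k))).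
Proof.
apply: csqrt; apply: continuous_mulfun; first exact: cst_continuous.
exact: (cont_comp (@csg_val_continuous _ K) crho).
Qed.

Lemma restrict_K_unitary : unitary_op A B U.
Proof.
split.
- move=> xi [wxi cov ixi]; split; last by rewrite restrict_K_norm.
  have := weakly_measurable_rep hip hpi hG hK wxi (@csg_val_continuous _ K)
    (@cst_continuous _ _ 1%g) csq.
  by congr weakly_measurable; apply/funext => k; rewrite invg1 (rep1 hpi).
- move=> xi1 xi2 [_ cov1 _] [_ cov2 _]; rewrite /= ind_aeE//.
  split; apply: negligibleS => k /= ne e; apply: ne; last by rewrite /restrict_K e.
  move: e => /scalerI; apply.
  by rewrite fmorph_eq0 gt_eqF// sqrtr_gt0.
- move=> z xi1 xi2 _ _; apply: aeW => k.
  by rewrite /restrict_K scalerDr !scalerA mulrC.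
- by move=> xi1 xi2 [_ cov1 _] [_ cov2 _]; exact: restrict_K_ip.
- move=> F [wF iF].
  pose xi x := ((Num.sqrt (c * rho (csg_val (kpart x))))^-1)%:C%C *:
    pi ((hpart x)^-1)%g (F (kpart x)).
  have UF : U xi = F.
    apply/funext => k; rewrite /restrict_K /xi (kpart_val KHG kh_part).
    rewrite (hpart_val KHG kh_part) invg1 (rep1 hpi) scalerA -rmorphM divff ?scale1r//.
    by rewrite gt_eqF// sqrtr_gt0.
  have cov : covariant xi.
    apply: aeW => x h; have [kE hE] := kh_partMr KHG kh_part x h.
    by rewrite /xi kE hE invgM (repM hpi) (repZ hpi).
  exists xi; last by rewrite UF; exact: aeW.
  split => //; last by rewrite -restrict_K_norm// UF.
  apply: (weakly_measurable_rep hip hpi hK hG wF ckpart chpart).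
  apply: continuous_invfun; first by move=> x; rewrite gt_eqF// sqrtr_gt0.
  exact: (cont_comp ckpart csq).
Qed.

(** Norms and inner products are read on K through [restrict_K], where the action becomes [sigma];
    no change of variables on G/H is needed. *)
Lemma ind_unitary_action : unitary_action A s.
Proof.
have dom x xi : fs_dom A xi -> fs_dom A (s x xi).
  move=> [wxi cov ixi]; split.
  - exact: ind_action_weakly_measurable.
  - exact: ind_action_covariant.
  - rewrite -restrict_K_norm; last exact: ind_action_covariant.
    rewrite (@ae_ge0_eq_integralT _ (borel K) R muK _
      (fun k => (normR (sigma x (U xi) k) ^+ 2)%:E)).
    + by rewrite sigma_integrable restrict_K_norm.
    + by move=> k; rewrite lee_fin sqr_ge0.
    + by move=> k; rewrite lee_fin sqr_ge0.
    + apply: negligibleS (restrict_K_intertwines x cov) => k /= ne e.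
      by apply: ne; rewrite e.
split=> [x|x y xi _]; last by apply: aeW => z; exact: ind_actionM.
split.
- exact: dom.
- by move=> xi1 xi2 _ _; exact: ind_action_aeE.
- move=> z xi1 xi2 _ _; apply: aeW => y.
  by rewrite /s /ind_action scalerDr !scalerA mulrC.
- move=> xi1 xi2 [_ cov1 _] [_ cov2 _].
  rewrite -!restrict_K_ip//; try exact: ind_action_covariant.
  rewrite -[RHS](sigma_ip x); apply: ae_complex_integral.
  have := negligibleU (restrict_K_intertwines x cov1) (restrict_K_intertwines x cov2).
  apply: negligibleS => k /= ne.
  by apply: contrapT => /not_orP[/contrapT e1 /contrapT e2]; apply: ne; rewrite e1 e2.
- move=> xi Axi; exists (s x^-1%g xi); first exact: dom.
  by apply: aeW => z; rewrite -ind_actionM mulgV ind_action1.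
Qed.

End equivalence.

Theorem proposition3p1
  (R : realType) (G : topGroupType) (lcG : locally_compact_group G)
  (H K : closed_subgroup G)
  (KH1 : csg_set K `&` csg_set H = [set 1%g])
  (KHG : homeomorphism
           (fun kh : K * H => (csg_val kh.1 * csg_val kh.2)%g))
  (kpart : G -> K) (hpart : G -> H)
  (kh_part : forall x : G, x = (csg_val (kpart x) * csg_val (hpart x))%g)
  (muG : {measure set (borel G) -> \bar R}) (haarG : left_haar muG)
  (muH : {measure set (borel H) -> \bar R}) (haarH : left_haar muH)
  (muK : {measure set (borel K) -> \bar R}) (haarK : left_haar muK)
  (DeltaG : G -> R) (modG : modular_function muG DeltaG)
  (DeltaH : H -> R) (modH : modular_function muH DeltaH)
  (rho : G -> R) (hrho : rho_function DeltaG DeltaH rho)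
  (p : coset_space H -> G) (hp : cross_section p)
  (mu_rho : {measure set (borel (coset_space H)) -> \bar R})
  (hmu_rho : rho_measure muG muH rho p mu_rho)
  (V : completeNormedModType R[i]) (ip : {dot V for Num.conj})
  (hip : hilbert_inner ip)
  (pi : H -> V -> V) (hpi : unitary_rep ip pi) :
  unitarily_equivalent
    (ind_space ip pi muG p mu_rho) (ind_action rho)
    (L2 ip muK) (sigma_action pi DeltaG DeltaH kpart hpart).
Proof.
have [c c0 [mu_rhoE _]] :=
  rho_measure_K lcG KHG kh_part haarG haarH haarK hrho hp hmu_rho.
split.
- exact: (ind_unitary_action lcG KHG kh_part haarG haarH haarK hrho hp hmu_rho
    hip hpi c0 mu_rhoE).
- exact: (sigma_unitary_action lcG KHG kh_part haarG haarH haarK hrho hp hmu_rho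
    hip hpi).
exists (restrict_K rho c).
  exact: (restrict_K_unitary lcG KHG kh_part haarG haarK hrho hp hip hpi c0 mu_rhoE).
move=> x xi [_ cov _].
exact: (restrict_K_intertwines lcG KHG kh_part haarG haarK hrho hpi c0 x cov).
Qed.
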